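(* Let $S$ be a finite inverse semigroup and let $\alpha$ be an automorphism of $S$ of prime order such that $\mathrm{Fix}(\alpha) = E(S)$. Then $S$ is a Clifford semigroup, and every maximal subgroup of $S$ (i.e. every $\mathcal{H}$-class of $S$, each of which is a group) is a nilpotent group. Equivalently, $S$ is a nilpotent Clifford semigroup in the sense of Kowol and Mitsch.
   Context: For a semigroup $S$, $E(S)$ denotes its set of idempotents, and for an automorphism $\alpha$ of $S$ (written on the right, $x\mapsto x\alpha$), $\mathrm{Fix}(\alpha) = \{x\in S \mid x\alpha = x\}$. An inverse semigroup is a semigroup in which every element $x$ has a unique inverse $x^{-1}$ with $xx^{-1}x=x$ and $x^{-1}xx^{-1}=x^{-1}$. A Clifford semigroup is an inverse semigroup in which $xx^{-1}=x^{-1}x$ for all $x$; equivalently, a strong semilattice of groups. For finite Clifford semigroups, nilpotence in the sense of Kowol and Mitsch is equivalent to every one of the constituent groups (the maximal subgroups) being nilpotent. *)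

(* Defs.v *)
From HB Require Import structures.
From mathcomp Require Import all_boot all_order all_fingroup all_solvable.
Set Implicit Arguments. Unset Strict Implicit. Unset Printing Implicit Defensive.

Section Semigroups.
Variables (S : finType) (mul : S -> S -> S).

Definition is_inverse_of (x y : S) : Prop :=
  mul (mul x y) x = x /\ mul (mul y x) y = y.

Definition inverse_semigroup : Prop :=
  associative mul /\ forall x : S, exists! y : S, is_inverse_of x y.

Definition idempotent_el (x : S) : Prop := mul x x = x.

Definition clifford : Prop :=
  forall x y : S, is_inverse_of x y -> mul x y = mul y x.

(* Green's relations, using S^1 (adjoining an identity) *)
Definition in_right_ideal1 (x y : S) : Prop := x = y \/ exists s, x = mul y s.
Definition in_left_ideal1 (x y : S) : Prop := x = y \/ exists s, x = mul s y.
Definition greenR (x y : S) : Prop := in_right_ideal1 x y /\ in_right_ideal1 y x.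
Definition greenL (x y : S) : Prop := in_left_ideal1 x y /\ in_left_ideal1 y x.
Definition greenH (x y : S) : Prop := greenR x y /\ greenL x y.

(* The maximal subgroup at an idempotent e, H_e, is the H-class of e.
   "H_e is a nilpotent group": H_e is isomorphic (via a multiplicative
   bijection) to a nilpotent finite group in the sense of mathcomp. *)
Definition nilpotent_maximal_subgroup (e : S) : Prop :=
  exists (gT : finGroupType) (f : gT -> S),
    [/\ injective f,
        (forall a b : gT, f (a * b)%g = mul (f a) (f b)),
        (forall x : S, greenH x e <-> exists a : gT, f a = x)
      & nilpotent [set: gT]].

End Semigroups.

Section Automorphisms.
Variables (S : finType) (mul : S -> S -> S).

Definition semigroup_automorphism (alpha : S -> S) : Prop :=
  bijective alpha /\ forall x y, alpha (mul x y) = mul (alpha x) (alpha y).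

Definition aut_order (alpha : S -> S) (n : nat) : Prop :=
  0 < n /\ (forall x, iter n alpha x = x) /\
  (forall k, 0 < k < n -> exists x, iter k alpha x <> x).

End Automorphisms.

(* Main.v *)
Require Import Defs.
From mathcomp Require Import all_boot all_order all_fingroup all_solvable.
From mathcomp Require Import ssralg finalg zmodp matrix mxrepresentation mxabelem.
Set Implicit Arguments. Unset Strict Implicit. Unset Printing Implicit Defensive.
Import GroupScope.

(** The automorphism [alpha] restricts to each maximal subgroup [H_e] as a
    fixed-point-free automorphism with [alpha ^ p = 1], so [H_e] is nilpotent by a
    theorem of Thompson. If [y] is the inverse of [x], then [alpha x = x g] for some
    [g] in [H_(yx)]; fixed-point-freeness gives [h] with [g alpha(h) = h], so that [x h]
    is fixed, hence idempotent, and this forces [xy = yx].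

    Thompson's theorem is obtained from his normal [p]-complement theorem, applied to an
    invariant Sylow subgroup for an odd prime [p]: either a nontrivial [p]-subgroup or a
    [p]-complement is normal and invariant, so by induction the group is solvable. In the
    solvable case, a sum over a Frobenius group shows that the [q']-elements centralize
    a minimal normal [q]-subgroup. A minimal counterexample to the normal [p]-complement
    theorem has [G / O_p(G)] an extension of an abelian [p']-group by a [p]-group, and an
    abelian subgroup of maximal order outside [O_p(G)] would yield an element acting
    quadratically, and so trivially since [p] is odd, on [Omega_1(Z(O_p(G)))]. *)

(** * Normal p-complements *)

(** Existence of a normal [p]-complement, phrased through the only subgroup that can be one. *)
Definition p_nilpotent (p : nat) (gT : finGroupType) (G : {set gT}) :=
  p.-group (G / 'O_p^'(G)).

Section PNilpotent.
Variables (p : nat) (gT : finGroupType).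
Implicit Types G H K M P : {group gT}.

Lemma p_nilpotentP G :
  reflect (exists K : {group gT}, [/\ K <| G, p^'.-group K & p.-group (G / K)])
          (p_nilpotent p G).
Proof.
apply: (iffP idP) => [nilG | [K [nKG p'K pGK]]].
  by exists 'O_p^'(G)%G; rewrite pcore_normal pcore_pgroup.
rewrite /p_nilpotent /pgroup.
have sKO : K \subset 'O_p^'(G) by rewrite pcore_max.
have -> : #|G / 'O_p^'(G)| = #|(G / K) / ('O_p^'(G) / K)|.
  by apply/card_isog; rewrite isog_sym third_isog ?pcore_normal.
exact: quotient_pgroup pGK.
Qed.

Lemma p_nilpotentE G : p_nilpotent p G = p^'.-Hall(G) 'O_p^'(G).
Proof.
rewrite /p_nilpotent /pHall pcore_sub pcore_pgroup pnatNK /=.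
by rewrite /pgroup card_quotient // normal_norm ?pcore_normal.
Qed.

Lemma p_nilpotentS G H : H \subset G -> p_nilpotent p G -> p_nilpotent p H.
Proof.
move=> sHG /p_nilpotentP[K [nKG p'K pGK]]; apply/p_nilpotentP.
exists (H :&: K)%G; split; first exact: normalGI nKG.
  by rewrite (pgroupS _ p'K) ?subsetIr.
have nKH := subset_trans sHG (normal_norm nKG).
rewrite /pgroup; have -> : #|H / (H :&: K)| = #|H / K|.
  by rewrite setIC; apply/card_isog; apply: second_isog.
exact: (@pgroupS _ p (G / K) (H / K) (quotientS _ sHG) pGK).
Qed.

Lemma p_nilpotent_nil G : nilpotent G -> p_nilpotent p G.
Proof. by move=> nilG; rewrite p_nilpotentE nilpotent_pcore_Hall. Qed.

Lemma p_nilpotent_pgroup G : p_nilpotent p G -> 'O_p^'(G) = 1 -> p.-group G.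
Proof.
rewrite /p_nilpotent => pG O1.
by move: pG; rewrite O1 /pgroup -(card_isog (quotient1_isog G)).
Qed.

Lemma p_nilpotent_ext G M :
  M <| G -> p.-group (G / M) -> p_nilpotent p M -> p_nilpotent p G.
Proof.
move=> nMG pGM nilM; apply/p_nilpotentP; exists 'O_p^'(M)%G.
have nOG : 'O_p^'(M) <| G by rewrite gFnormal_trans.
split; rewrite ?pcore_pgroup //.
rewrite -(pquotient_pgroup (G := G / 'O_p^'(M)) (K := (M / 'O_p^'(M))%G)) //.
  rewrite /pgroup; have -> : #|(G / 'O_p^'(M)) / (M / 'O_p^'(M))| = #|G / M|.
    by apply/card_isog/third_isog; rewrite ?pcore_sub.
  by [].
by rewrite quotient_norms // normal_norm.
Qed.

Lemma p_nilpotent_p'ext G M :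
  M <| G -> p^'.-group M -> p_nilpotent p (G / M) -> p_nilpotent p G.
Proof.
move=> nMG p'M; rewrite /p_nilpotent => pG.
apply/p_nilpotentP; have [K defK sMK nKG] := inv_quotientN nMG (pcore_normal p^' (G / M)).
exists K; split => //.
  rewrite -(pquotient_pgroup p'M) ?(subset_trans (normal_sub nKG)) ?normal_norm //.
  by rewrite -defK pcore_pgroup.
rewrite /= defK in pG.
rewrite /pgroup; have <- : #|(G / M) / (K / M)| = #|G / K| by apply/card_isog; rewrite third_isog.
by [].
Qed.

End PNilpotent.

Lemma p_nilpotent_morphim p (aT rT : finGroupType) (D G : {group aT})
  (f : {morphism D >-> rT}) : G \subset D -> p_nilpotent p G -> p_nilpotent p (f @* G).
Proof.
move=> sGD /p_nilpotentP[K [nKG p'K pGK]]; apply/p_nilpotentP.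
exists (f @* K)%G; split; [exact: morphim_normal | exact: morphim_pgroup | ].
have sKG := normal_sub nKG.
rewrite /pgroup /= card_quotient ?morphim_norms ?normal_norm //.
rewrite morphim_p_index ?(subset_trans sKG) //.
by move: pGK; rewrite /pgroup card_quotient ?normal_norm.
Qed.

Lemma p_nilpotentJ p (gT : finGroupType) (G : {group gT}) x :
  p_nilpotent p (G :^ x) = p_nilpotent p G.
Proof. by rewrite !p_nilpotentE pcoreJ pHallJ2. Qed.

Lemma p_nilpotent_quotient p (gT : finGroupType) (G H : {group gT}) :
  G \subset 'N(H) -> p_nilpotent p G -> p_nilpotent p (G / H).
Proof. exact: p_nilpotent_morphim. Qed.

(** * Frobenius' normal p-complement theorem *)

Section Frobenius.
Variables (p : nat) (gT : finGroupType).
Implicit Types G H K M P Q X : {group gT}.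

(** Normal subgroups of coprime orders commute, as their commutator lies in both. *)
Lemma pcore_p'_sub_cent M X : X <| M -> p.-group X -> 'O_p^'(M) \subset 'C(X).
Proof.
move=> nXM pX; have nOM := pcore_normal p^' M.
have co : coprime #|X| #|'O_p^'(M)| by exact: pnat_coprime pX (pcore_pgroup _ _).
apply/commG1P; apply/trivgP; rewrite -(coprime_TIg co) setIC commg_subI //.
  by rewrite subsetI subxx (subset_trans (pcore_sub _ _) (normal_norm nXM)).
by rewrite subsetI subxx (subset_trans (normal_sub nXM) (normal_norm nOM)).
Qed.

(* Downward induction on [|P :&: Q|]: in ['N_G(P :&: Q)], Sylow subgroups are conjugate under
   the normal p-complement, which centralizes [P :&: Q]. *)
Lemma Sylow_conj_cent G :
    (forall X, X \subset G -> p.-group X -> X :!=: 1 -> p_nilpotent p 'N_G(X)) ->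
  forall P Q, p.-Sylow(G) P -> p.-Sylow(G) Q ->
  exists2 c, c \in 'C_G(P :&: Q) & Q :=: P :^ c.
Proof.
move=> nilN P Q; have [n] := ubnP (#|G| - #|P :&: Q|).
elim: n P Q => // n IHn P Q /ltnSE leGn sylP sylQ.
have [sPG pP _] := and3P sylP; have [sQG pQ _] := and3P sylQ.
have [D1 | ntD] := eqVneq (P :&: Q) 1.
  have [c Gc defQ] := Sylow_trans sylP sylQ; exists c => //.
  by rewrite D1 inE Gc cent1T inE.
have [sPQ | not_sPQ] := boolP (P \subset Q).
  exists 1; first exact: group1.
  by rewrite conjsg1 (sub_pHall sylP pQ sPQ sQG).
have not_sQP : ~~ (Q \subset P).
  by apply: contra not_sPQ => sQP; rewrite (sub_pHall sylQ pP sQP sPG).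
pose D := (P :&: Q)%G.
have pD : p.-group D by rewrite (pgroupS _ pP) ?subsetIl.
have sDG : D \subset G by rewrite subIset ?sPG.
have DP : D \proper P by rewrite /proper subsetIl subsetI subxx.
have DQ : D \proper Q by rewrite /proper subsetIr subsetI subxx andbT.
have DNP := nilpotent_proper_norm (pgroup_nil pP) DP.
have DNQ := nilpotent_proper_norm (pgroup_nil pQ) DQ.
have pN1 : p.-group 'N_P(D) by rewrite (pgroupS _ pP) ?subsetIl.
have pN2 : p.-group 'N_Q(D) by rewrite (pgroupS _ pQ) ?subsetIl.
have [R sylR sNR] := Sylow_superset (setSI 'N(D) sPG) pN1.
have [S sylS sNS] := Sylow_superset (setSI 'N(D) sQG) pN2.
have nilND := nilN D sDG pD ntD; rewrite p_nilpotentE in nilND.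
have nDN : D <| 'N_G(D) by rewrite /normal subsetI sDG normG subsetIr.
have sylR' : p^'^'.-Hall('N_G(D)) R by rewrite (eq_pHall _ _ (negnK p)).
have /sdprodP[_ defN _ _] := sdprod_Hall_pcoreP nilND sylR'.
have [x Nx defS] := Sylow_trans sylR sylS.
have Nx' : x^-1 \in 'O_p^'('N_G(D)) * R by rewrite defN groupV.
have [k r Kk Rr defx] := mulsgP Nx'.
have {defx} defS : S :=: R :^ k^-1.
  by rewrite defS -[x]invgK defx invMg conjsgM (conjGid (groupVr Rr)).
have Ck : k^-1 \in 'C_G(D).
  rewrite groupV inE (subsetP (pcore_p'_sub_cent nDN pD)) // andbT.
  by have /setIP[] := subsetP (pcore_sub _ _) _ Kk.
have [Gk CDk] := setIP Ck.
have [sRN pR _] := and3P sylR.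
have [P1 sylP1 sRP1] := Sylow_superset (subset_trans sRN (subsetIl _ _)) pR.
have lt_card (A B : {group gT}) : D \proper B -> A \subset G -> B \subset A -> #|G| - #|A| < n.
  move=> DB sAG sBA; apply: leq_trans leGn; apply: ltn_sub2l.
    exact: leq_trans (proper_card DB) (subset_leq_card (subset_trans sBA sAG)).
  exact: leq_trans (proper_card DB) (subset_leq_card sBA).
have sNPP1 : 'N_P(D) \subset P :&: P1 by rewrite subsetI subsetIl (subset_trans sNR).
have [c1 /setIP[Gc1 Cc1] defP1] : exists2 c, c \in 'C_G(P :&: P1) & P1 :=: P :^ c.
  by apply: IHn => //; apply: lt_card sNPP1; rewrite ?subIset ?sPG.
have sylP1k : p.-Sylow(G) (P1 :^ k^-1)%G by rewrite pHallJ.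
have sNQP1 : 'N_Q(D) \subset (P1 :^ k^-1) :&: Q.
  by rewrite subsetI subsetIl (subset_trans sNS) // defS conjSg.
have [c2 /setIP[Gc2 Cc2] defQ] :
    exists2 c, c \in 'C_G((P1 :^ k^-1)%G :&: Q) & Q :=: (P1 :^ k^-1)%G :^ c.
  apply: IHn => //; apply: (@lt_card ((P1 :^ k^-1)%G :&: Q)%G _ DNQ _ sNQP1).
  by rewrite subIset ?sQG ?orbT.
exists (c1 * k^-1 * c2); last by rewrite defQ /= defP1 -!conjsgM !mulgA.
rewrite inE !groupM //= -/D.
  apply: subsetP Cc1; apply: centS; exact: subset_trans (proper_sub DNP) sNPP1.
apply: subsetP Cc2; apply: centS; exact: subset_trans (proper_sub DNQ) sNQP1.
Qed.

(** Both [P :^ g] and [P] contain [x ^ g], so some [c] centralizing [x ^ g] carries the first to the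
    second. Then [g * c] normalizes [P], and the normal complement in ['N_G(P)] centralizes [P], so
    only the [P]-part of [g * c] acts on [x]. *)
Lemma Sylow_control_fusion G P x g :
    (forall X, X \subset G -> p.-group X -> X :!=: 1 -> p_nilpotent p 'N_G(X)) ->
    p.-Sylow(G) P -> g \in G -> x \in P -> x ^ g \in P ->
  exists2 u, u \in P & x ^ g = x ^ u.
Proof.
move=> nilN sylP Gg Px Pxg; have [sPG pP _] := and3P sylP.
have [P1 | ntP] := eqVneq P 1%G.
  by exists 1 => //; move: Px; rewrite P1 inE => /eqP->; rewrite !conj1g.
have sylPg : p.-Sylow(G) (P :^ g)%G by rewrite pHallJ.
have [c /setIP[Gc Cc] /= defP] := Sylow_conj_cent nilN sylPg sylP.
have Ngc : g * c \in 'N_G(P) by rewrite inE groupM //= inE conjsgM -defP.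
have nilNP := nilN P sPG pP ntP; rewrite p_nilpotentE in nilNP.
have nPN : P <| 'N_G(P) by rewrite /normal subsetI sPG normG subsetIr.
have sylR' : p^'^'.-Hall('N_G(P)) P.
  by rewrite (eq_pHall _ _ (negnK p)) Sylow_subnorm.
have /sdprodP[_ defN _ _] := sdprod_Hall_pcoreP nilNP sylR'.
move: Ngc; rewrite -defN => /mulsgP[k u Kk Pu defgc].
exists u => //; have Ck := subsetP (pcore_p'_sub_cent nPN pP) k Kk.
have -> : x ^ g = x ^ (g * c).
  rewrite conjgM [(x ^ g) ^ c]conjgE -(centP Cc) ?mulKg //.
  by rewrite inE Pxg memJ_conjg Px.
by rewrite defgc conjgM [x ^ k]conjgE -(centP Ck) ?mulKg.
Qed.

(* By fusion, the transfer [G -> P / P^`(1)] is [x |-> x ^+ #|G : P|] on [P]. *)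
Lemma Sylow_fusion_p_quotient G P :
    p.-Sylow(G) P -> P :!=: 1 ->
    (forall x g, g \in G -> x \in P -> x ^ g \in P ->
       exists2 u, u \in P & x ^ g = x ^ u) ->
  exists K, [/\ K <| G, K \proper G & p.-group (G / K)].
Proof.
move=> sylP ntP fusP; have [sPG pP p'GP] := and3P sylP.
pose alpha := restrm_morphism (der_norm 1 P) (coset_morphism P^`(1)).
have defaP : alpha @* P = P / P^`(1) by rewrite morphim_restrm setIid.
have abA : abelian (alpha @* P) by rewrite defaP der_abelian.
pose tau := transfer_morphism G abA.
have pT : p.-group [set: FiniteModule.fmod_of abA].
  have <- : FiniteModule.fmod_morphism abA @* (alpha @* P) = setT.
    apply/setP=> u; rewrite inE -[u](FiniteModule.fmvalK).
    apply: mem_morphim; exact: FiniteModule.fmodP.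
  by rewrite morphim_pgroup //= defaP quotient_pgroup.
exists ('ker tau)%G; rewrite /= ker_normal; split=> //.
  rewrite properEneq (normal_sub (ker_normal tau)) andbT; apply/eqP => kerG.
  have /properP[_ [x Px notP'x]] : P^`(1) \proper P.
    by rewrite (sol_der1_proper (pgroup_sol pP)).
  case/negP: notP'x.
  have Gx := subsetP sPG x Px.
  have: tau x = 1 by apply: mker; rewrite kerG.
  have trX := transversalP (@rcosets_cycle_partition _ G P sPG x Gx).
  rewrite /= (transfer_cycle_expansion sPG abA Gx trX).
  have aPx : coset P^`(1) x \in alpha @* P by rewrite defaP mem_quotient.
  pose a := FiniteModule.fmod abA (coset P^`(1) x).
  have nP'P : P \subset 'N(P^`(1)) := der_norm 1 P.
  (* Each factor of the transfer is a power of [x] conjugated in [G] back into [P]; by fusion it is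
     conjugate to that power in [P], so equal to it modulo the derived subgroup. *)
  rewrite (eq_bigr (fun y => a *+ #|<[x]> : P :* y|)%R); last first.
    move=> y Xy; have Gy : y \in G by exact: subsetP (transversal_sub trX) y Xy.
    have Pxn : (x ^+ #|<[x]> : P :* y|) ^ y^-1 \in P.
      have := mulg_exp_card_rcosets P x y; rewrite mem_rcoset.
      by rewrite conjgE invgK mulgA.
    have [u Pu ->] := fusP _ _ (groupVr Gy) (groupX _ Px) Pxn.
    rewrite /restrm /= (morphJ (coset_morphism P^`(1))) ?groupX ?(subsetP nP'P) //.
    rewrite (morphX (coset_morphism P^`(1))) ?(subsetP nP'P) //= /a -FiniteModule.fmodX.
      congr (FiniteModule.fmod abA _); apply/conjg_fixP/commgP.
      by apply: (centsP (der_abelian 0 P)); rewrite ?groupX ?mem_quotient.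
    exact: aPx.
  rewrite GRing.sumrMnr (sum_index_rcosets_cycle sPG Gx trX) => /(congr1 FiniteModule.fmval).
  rewrite FiniteModule.fmvalZ FiniteModule.fmodK // => xn1.
  (* The image of [x] is a [p]-element killed by an index prime to [p], so it is trivial, against
     the choice of [x]. *)
  have co : coprime #[coset P^`(1) x] #|G : P|.
    apply: (pnat_coprime (pi := p)) p'GP.
    by apply: mem_p_elt (quotient_pgroup _ pP) _; rewrite mem_quotient.
  apply: coset_idr; first exact: subsetP nP'P x Px.
  have dv : #[coset P^`(1) x] %| #|G : P| by rewrite order_dvdn; apply/eqP.
  by apply/eqP; rewrite -order_eq1; have := coprime_dvdr dv co; rewrite /coprime gcdnn.
rewrite /pgroup (card_isog (first_isog tau)).
exact: (pgroupS (subsetT (tau @* G)) pT).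
Qed.

(** Unless [G] is a [p']-group, fusion gives a proper normal subgroup with [p]-quotient. It inherits
    the hypothesis on normalizers, and its normal complement, being characteristic in it, is one for
    [G]. *)
Theorem Frobenius_normal_p_complement G :
    (forall X, X \subset G -> p.-group X -> X :!=: 1 -> p_nilpotent p 'N_G(X)) ->
  p_nilpotent p G.
Proof.
have [n] := ubnP #|G|; elim: n G => // n IHn G /ltnSE leGn nilN.
have [P sylP] := Sylow_exists p G.
have [sPG pP p'GP] := and3P sylP.
have [P1 | ntP] := eqVneq (gval P) 1.
  apply/p_nilpotentP; exists G; rewrite normal_refl trivg_quotient pgroup1; split=> //.
  by move: p'GP; rewrite P1 indexg1.
have [K [nKG prKG pGK]] := Sylow_fusion_p_quotient sylP ntP
  (fun x g Gg Px => @Sylow_control_fusion G P x g nilN sylP Gg Px).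
apply: p_nilpotent_ext nKG pGK _; apply: IHn => [|X sXK pX ntX].
  exact: leq_trans (proper_card prKG) leGn.
have sKG := proper_sub prKG.
apply: p_nilpotentS (nilN X (subset_trans sXK sKG) pX ntX).
by rewrite setSI.
Qed.

End Frobenius.

(** * Quadratic action *)

Section QuadraticRing.
Import GRing.Theory.
Local Open Scope ring_scope.

(* Writing [X = 1 + N] with [N ^+ 2 = 0], the difference of the two conjugates of [Y] is
   twice [C = Y N - N Y]. So [C] commutes with [Y], and [Y ^+ m] acts on [N] like a
   derivation: [Y ^+ m * N = N * Y ^+ m + m Y ^+ (m - 1) C]. *)
Lemma quadratic_comm (R : pzRingType) (X Xi Y : R) m :
    X * Xi = 1 -> Xi * X = 1 -> (X - 1) * (X - 1) = 0 ->
    GRing.comm Y (Xi * Y * X) -> GRing.comm Y (X * Y * Xi) ->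
    (forall z : R, z *+ 2 = 0 -> z = 0) -> (forall z : R, z *+ m = 0 -> z = 0) ->
    Y ^+ m = 1 ->
  GRing.comm Y X.
Proof.
move=> XXi XiX N2 cY1 cY2 inj2 injm Ym.
(* For [m = 0] the injectivity hypothesis says that every element of the ring is zero. *)
case: m injm Ym => [inj0 _|m injm Ym].
  by rewrite /GRing.comm; apply: subr0_eq; apply: inj0; rewrite mulr0n.
move: N2; move defN : (X - 1) => N N2; have defX : X = 1 + N by rewrite -defN addrC subrK.
have defXi : Xi = 1 - N.
  have XN : X * (1 - N) = 1.
    by rewrite defX mulrDl mul1r mulrBr mulr1 [N * N]N2 subr0 subrK.
  by rewrite -[LHS]mulr1 -{1}XN mulrA XiX mul1r.
pose C := Y * N - N * Y.
have E1 : Xi * Y * X = Y + C - N * Y * N.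
  rewrite defX defXi mulrDr mulr1 !mulrBl !mul1r /C -!addrA; congr (_ + _).
  by rewrite addrCA.
have E2 : X * Y * Xi = Y - C - N * Y * N.
  by rewrite defX defXi mulrBr mulr1 !mulrDl !mul1r /C opprB opprD -!addrA.
have cYC : GRing.comm Y C.
  have: GRing.comm Y (C *+ 2).
    have -> : C *+ 2 = Xi * Y * X - X * Y * Xi.
      rewrite E1 E2 !opprD !opprK addrACA [Y + C + _]addrACA subrr add0r.
      by rewrite [- _ + _]addrC subrr addr0.
    exact: commrB.
  rewrite /GRing.comm mulrnAr mulrnAl => /eqP; rewrite -subr_eq0 -mulrnBl => /eqP /inj2.
  exact: subr0_eq.
have powY k : Y ^+ k.+1 * N = N * Y ^+ k.+1 + (Y ^+ k * C) *+ k.+1.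
  elim: k => [|k IHk]; first by rewrite !expr1 mul1r mulr1n addrC subrK.
  rewrite exprS -mulrA IHk mulrDr mulrA -[Y * N](subrK (N * Y)) -/C mulrDl.
  rewrite (commrX k.+1 (commr_sym cYC)) mulrnAr -mulrA -!exprS mulrA -exprS.
  by rewrite [_ *+ k.+2]mulrS addrA [N * _ + _]addrC.
have /eqP := powY m; rewrite Ym mulr1 mul1r -subr_eq0 opprD addNKr.
rewrite oppr_eq0 => /eqP/injm mC0.
have C0 : C = 0 by rewrite -[LHS]mul1r -Ym exprS -mulrA mC0 mulr0.
by apply: subr0_eq; rewrite defX mulrDr mulrDl mulr1 mul1r opprD addrACA subrr add0r.
Qed.
End QuadraticRing.

Section QuadraticGroup.
Variables (p : nat) (gT : finGroupType).
Implicit Types V : {group gT}.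

(** The representation of ['N(V)] on [V] over ['F_p] has kernel ['C(V)], so commutators in ['C(V)]
    become commuting matrices. Then [quadratic_comm] applies with [m] the order of [y], which is
    prime to [p]. *)
Lemma quadratic_commutator_cent V x y :
    odd p -> p.-abelem V -> x \in 'N(V) -> y \in 'N(V) -> p^'.-elt y ->
    {in V, forall v, [~ v, x, x] = 1} ->
    [~ y, y ^ x] \in 'C(V) -> [~ y, y ^ x^-1] \in 'C(V) ->
  [~ x, y] \in 'C(V).
Proof.
move=> odd_p abelV nVx nVy p'y V_xx cy1 cy2.
have [V1 | ntV] := eqVneq (gval V) 1; first by rewrite V1 cent1T inE.
have [pV abV expV] := and3P abelV.
have [p_pr _ _] := pgroup_pdiv pV ntV.
pose rG := abelem_repr abelV ntV (subxx 'N(V)).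
have rG1 : rG 1 = 1%R by rewrite repr_mx1.
have rGM a b : a \in 'N(V) -> b \in 'N(V) -> rG (a * b) = (rG a * rG b)%R.
  exact: repr_mxM.
have rGC z : z \in 'N(V) -> (z \in 'C(V)) = (rG z == 1%R).
  move=> Nz; have := rker_abelem abelV ntV (subxx 'N(V)).
  move/setP/(_ z); rewrite [in RHS]inE Nz /= => <-.
  by apply/idP/eqP => [/rkerP[] | Gz1] //; apply/rkerP.
have comm_rG a b : a \in 'N(V) -> b \in 'N(V) ->
    ([~ a, b] \in 'C(V)) = (rG a * rG b == rG b * rG a)%R.
  move=> Na Nb; rewrite rGC ?groupR // -(rGM a b) // -(rGM b a) // [a * b]commgC.
  rewrite (rGM (b * a)) ?groupR ?groupM //.
  apply/eqP/eqP => [-> | eq1]; first by rewrite GRing.mulr1.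
  have Nba : b * a \in 'N(V) by rewrite groupM.
  have := congr1 (GRing.mul (rG (b * a)^-1)) eq1.
  by rewrite GRing.mulrA -(rGM _ _ (groupVr Nba) Nba) mulVg rG1 GRing.mul1r.
have rGX k : rG (y ^+ k) = (rG y ^+ k)%R.
  by elim: k => [|k IHk]; rewrite ?expgS ?rGM ?groupX ?IHk // GRing.exprS.
have inj_nat k : ~~ (p %| k) ->
    forall z : 'M['F_p]_('dim V), (z *+ k = 0)%R -> (z = 0)%R.
  move=> pk z /eqP; rewrite -GRing.scaler_nat scalemx_eq0 => /orP[|/eqP] //.
  by rewrite -(GRing.dvdn_pcharf (pchar_Fp p_pr)) (negPf pk).
rewrite comm_rG //; apply/eqP; apply: GRing.commr_sym.
have nVx' : x^-1 \in 'N(V) by rewrite groupV.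
have nVJ z : z \in 'N(V) -> y ^ z \in 'N(V) by move=> Nz; rewrite groupJ.
apply: (@quadratic_comm _ (rG x) (rG x^-1) (rG y) #[y]).
- by rewrite -rGM // mulgV.
- by rewrite -rGM // mulVg.
- have rVB (u : 'rV['F_p]_('dim V)) :
      rVabelem abelV ntV (u *m (rG x - 1)) = [~ rVabelem abelV ntV u, x].
    rewrite mulmxBr mulmx1 rVabelemD rVabelemN rVabelemJ //.
    by rewrite commgEl (centsP abV) ?groupV ?memJ_norm ?mem_rVabelem.
  apply/row_matrixP => i; apply: (@rVabelem_inj _ _ _ abelV ntV).
  rewrite rowE -[(_ * _)%R]/((rG x - 1) *m (rG x - 1))%R mulmxA !rVB V_xx ?mem_rVabelem //.
  by rewrite row0 rVabelem0.
- move: cy1; rewrite comm_rG ?nVJ // conjgE !rGM ?groupM // => /eqP.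
  by rewrite /GRing.comm !GRing.mulrA.
- move: cy2; rewrite comm_rG ?nVJ // conjgE invgK !rGM ?groupM // => /eqP.
  by rewrite /GRing.comm !GRing.mulrA.
- by apply: inj_nat; rewrite dvdn_prime2 //; apply: contraTneq odd_p => ->.
- by apply: inj_nat; rewrite -p'natE.
by rewrite -rGX expg_order.
Qed.
End QuadraticGroup.

(** By induction [u] lies in every term of the lower central series. *)
Lemma nilpotent_fixed_commutator (gT : finGroupType) (G : {group gT}) u b :
  nilpotent G -> u \in G -> b \in G -> u = [~ u, b] -> u = 1.
Proof.
move=> nilG Gu Gb defu; have [n Ln1] := lcnP _ nilG.
have Lu k : u \in 'L_k.+1(G).
  by elim: k => [|k IHk]; rewrite ?lcn1 // lcnSn defu mem_commg.
by have := Lu n; rewrite Ln1 => /set1P.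
Qed.

(** * Quadratic offenders *)

Section Offender.
Variables (p : nat) (gT : finGroupType).
Implicit Types A B K V X : {group gT}.

(** In the abelian [V] the hypothesis says that [B] fixes [v ^ b * (v ^ b')^-1]. Conjugating by [c]
    in [B] then gives [[~ v, c] ^ b = [~ v, c] ^ b']. *)
Lemma commutator_coset_inj V B v b b' :
    abelian V -> abelian B -> B \subset 'N(V) -> v \in V -> b \in B -> b' \in B ->
    [~ v, b] * [~ v, b']^-1 \in 'C_V(B) ->
  b * b'^-1 \in 'C(commg_set [set v] B).
Proof.
move=> abV abB nVB Vv Bb Bb' /setIP[_ cd].
have Vc c : c \in B -> v ^ c \in V by move=> Bc; rewrite memJ_norm ?(subsetP nVB).
have comV a c : a \in V -> c \in V -> a * c = c * a.
  by move=> Va Vc'; apply: (centsP abV).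
have eqd : [~ v, b] * [~ v, b']^-1 = v ^ b * (v ^ b')^-1.
  have Vb : v^-1 * v ^ b \in V by apply: groupM; rewrite ?groupV ?Vc.
  have Vb' : (v ^ b')^-1 * v \in V by apply: groupM; rewrite ?groupV ?Vc.
  rewrite !commgEl invMg invgK (comV _ _ Vb Vb').
  by rewrite -mulgA mulKVg comV ?groupV ?Vc.
rewrite eqd in cd; have comB := centsP abB.
have eqJ (c : gT) : c \in B -> [~ v, c] ^ b = [~ v, c] ^ b'.
  move=> Bc.
  have defc: v ^ (b * c) * (v ^ (b' * c))^-1 = v ^ b * (v ^ b')^-1.
    by rewrite !conjgM -conjVg -conjMg conjgE (centP cd c Bc) mulKg.
  have RJ (d : gT) : d \in B -> [~ v, c] ^ d = (v ^ d)^-1 * v ^ (d * c).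
    by move=> Bd; rewrite commgEl conjMg conjVg -conjgM (comB c Bc d Bd).
  rewrite !RJ //; apply: (mulgI (v ^ b)); rewrite mulKVg mulgA -defc.
  by rewrite mulgKV.
apply/centP=> _ /imset2P[_ c /set1P-> Bc ->].
have := congr1 (conjg ^~ b'^-1) (eqJ c Bc) => /=.
by rewrite conjgK -conjgM => /conjg_fixP/commgP/commute_sym.
Qed.

(* So [b |-> [~ v, b]] induces an injection of [B / X] into ['C_V(X) / 'C_V(B)], whence
   [#|B| * #|'C_V(B)| <= #|X| * #|'C_V(X)|] as in Thompson's replacement theorem. *)
Lemma commutator_cent_index V B v :
    abelian V -> abelian B -> B \subset 'N(V) -> v \in V ->
    let X := 'C_B(commg_set [set v] B) in
    let f (r : {set gT}) := 'C_V(B) :* [~ v, repr r] in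
  [/\ {in rcosets X B &, injective f} & f @: rcosets X B \subset rcosets 'C_V(B) 'C_V(X)].
Proof.
move=> abV abB nVB Vv X f.
have Xr r : r \in rcosets X B -> repr r \in B /\ r = X :* repr r.
  case/rcosetsP=> b Bb ->; rewrite rcoset_repr; split=> //.
  by have /rcosetP[x /setIP[Bx _] ->] := mem_repr_rcoset [group of X] b; rewrite groupM.
split=> [r r' /Xr[Br defr] /Xr[Br' defr'] eqf | ].
  rewrite defr defr'; apply/rcoset_eqP; rewrite mem_rcoset inE groupM ?groupV //=.
  apply: (@commutator_coset_inj V B v) => //.
  by rewrite -mem_rcoset; apply/rcoset_eqP.
apply/subsetP=> _ /imsetP[r /Xr[Br _] ->]; apply/rcosetsP; exists [~ v, repr r] => //.
rewrite inE commgEl groupM ?groupV ?memJ_norm ?(subsetP nVB) //=.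
apply/centP=> x /setIP[Bx cx]; apply: commute_sym; apply: (centP cx).
by rewrite -commgEl; apply: imset2_f; rewrite ?set11.
Qed.

(* In the equality case the injection above is onto, so [v = c * [~ v, b]] with [c] fixed
   by [B]; then [~ v, b] = [~ v, b, b], which nilpotence makes trivial. *)
Lemma offender_commutator V B v :
    p.-group V -> p.-group B -> abelian V -> abelian B -> B \subset 'N(V) -> v \in V ->
    'C_B(commg_set [set v] B) \subset 'C(V) ->
    #|'C_B(V)| * #|V| <= #|B| * #|'C_V(B)| ->
  v \in 'C(B).
Proof.
move=> pV pB abV abB nVB Vv; set X := 'C_B(_) => sXC leKV.
have [injf subf] := commutator_cent_index abV abB nVB Vv.
have defX : X = 'C_B(V).
  apply/eqP; rewrite eqEsubset subsetI subsetIl sXC setIS // centS //.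
  apply/subsetP=> _ /imset2P[_ b /set1P-> Bb ->].
  by rewrite commgEl groupM ?groupV ?memJ_norm ?(subsetP nVB).
have CVX : 'C_V(X) = V by apply/setIidPl; rewrite centsC.
rewrite -/X CVX in injf subf.
have eqf : [set 'C_V(B) :* [~ v, repr r] | r in rcosets X B] = rcosets 'C_V(B) V.
  apply/eqP; rewrite eqEcard subf card_in_imset //.
  rewrite -!/(indexg _ _) -(leq_pmul2l (cardG_gt0 'C_V(B))) Lagrange ?subsetIl //.
  rewrite -(leq_pmul2l (cardG_gt0 'C_B(V))) (leq_trans leKV) // mulnCA.
  by rewrite defX Lagrange ?subsetIl // mulnC.
have: 'C_V(B) :* v \in rcosets 'C_V(B) V by apply/rcosetsP; exists v.
rewrite -eqf => /imsetP[r /rcosetsP[b0 Bb0 ->]].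
have [b Bb] : exists2 b, b \in B & repr (X :* b0) = b.
  exists (repr (X :* b0)) => //.
  by have /rcosetP[x /setIP[Bx _] ->] := mem_repr_rcoset [group of X] b0; rewrite groupM.
move=> -> /rcoset_eqP/rcosetP[c /setIP[Vc cBc] defv].
have cb : [~ c, b] = 1 by apply/eqP/commgP; apply: (centP cBc).
have defu : [~ v, b] = [~ v, b, b].
  by rewrite {1}defv commMgJ cb conj1g mul1g.
have nilVB : nilpotent (V <*> B).
  by apply: (@pgroup_nil _ p [group of V <*> B]); rewrite /= norm_joinEr // pgroupM pV.
have u1 : [~ v, b] = 1.
  apply: nilpotent_fixed_commutator nilVB _ _ defu.
    by rewrite groupR ?mem_gen ?inE ?Vv ?Bb ?orbT.
  by rewrite mem_gen ?inE ?Bb ?orbT.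
by rewrite defv u1 mulg1.
Qed.

(** Take [B] minimal for the inequality and let [X] be the centralizer in [B] of the commutators of
    [v] with [B]. If [X] centralizes [V], then [B] fixes [v] by [offender_commutator]; otherwise [X]
    inherits the inequality, so [X = B] by minimality, which is the quadratic condition. *)
Lemma quadratic_offender V A :
    p.-group V -> p.-group A -> abelian V -> abelian A -> A \subset 'N(V) ->
    ~~ (A \subset 'C(V)) -> #|'C_A(V)| * #|V| <= #|A| * #|'C_V(A)| ->
  exists B, [/\ B \subset A, ~~ (B \subset 'C(V)) &
             {in V & B &, forall v b c, [~ v, b, c] = 1}].
Proof.
move=> pV pA abV abA nVA ncA leA.
(* The condition ['C_A(V) \subset B] makes ['C_B(V)] equal to ['C_A(V)], so the left side of the
   inequality can stay fixed during the descent. *)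
pose gP B := [&& 'C_A(V) \subset B, B \subset A, ~~ (B \subset 'C(V))
  & #|'C_A(V)| * #|V| <= #|B| * #|'C_V(B)|].
have gPA : gP A by rewrite /gP subsetIl subxx ncA.
have [B /mingroupP[/and4P[sKB sBA ncB leB] minB] _] := mingroup_exists gPA.
exists B; split=> // v b c Vv Bb Bc.
have pB := pgroupS sBA pA; have abB := abelianS sBA abA.
have nVB := subset_trans sBA nVA.
have defK : 'C_B(V) = 'C_A(V).
  by apply/eqP; rewrite eqEsubset setSI // subsetI sKB subsetIr.
pose X := [group of 'C_B(commg_set [set v] B)].
have [injf subf] := commutator_cent_index abV abB nVB Vv.
have [sXC | nXC] := boolP (X \subset 'C(V)).
  have Cv : v \in 'C(B) by apply: (offender_commutator pV pB) => //; rewrite defK.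
  by rewrite (_ : [~ v, b] = 1) ?comm1g //; apply/eqP/commgP; apply: (centP Cv).
have sXB : X \subset B by apply: subsetIl.
have leX : #|B| * #|'C_V(B)| <= #|X| * #|'C_V(X)|.
  have sCC : 'C_V(B) \subset 'C_V(X) by rewrite setIS ?centS.
  rewrite -(Lagrange sXB) -(Lagrange sCC) -mulnA leq_mul2l; apply/orP; right.
  rewrite mulnC leq_mul2l; apply/orP; right.
  by have := subset_leq_card subf; rewrite (card_in_imset injf).
have defX : X :=: B.
  apply: minB sXB; rewrite /gP (subset_trans (subsetIl _ _) sBA) nXC (leq_trans leB leX).
  rewrite !andbT -defK setIS // centS //.
  apply/subsetP=> _ /imset2P[_ d /set1P-> Bd ->].
  by rewrite commgEl groupM ?groupV ?memJ_norm ?(subsetP nVB).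
have : c \in X by rewrite defX.
case/setIP=> _ /centP cc; apply/eqP/commgP; apply: commute_sym; apply: cc.
by apply: imset2_f; rewrite ?set11.
Qed.
End Offender.

(** * Thompson's normal p-complement theorem *)

Section ThompsonSubgroup.
Variable gT : finGroupType.
Implicit Types A B P U : {group gT}.

(** Maximality is by order, not by inclusion or rank, which fixes the version of the Thompson
    subgroup built from it. *)
Definition max_abelian (P : {set gT}) A :=
  [&& A \subset P, abelian A &
      [forall B : {group gT}, (B \subset P) && abelian B ==> (#|B| <= #|A|)]].

Definition Thompson_J (P : {set gT}) := <<\bigcup_(A : {group gT} | max_abelian P A) A>>.

Canonical Thompson_J_group P := [group of Thompson_J P].

Lemma max_abelianP (P : {set gT}) A :
  reflect [/\ A \subset P, abelian A &
             forall B, B \subset P -> abelian B -> #|B| <= #|A|] (max_abelian P A).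
Proof.
apply: (iffP and3P) => [[sAP abA /forallP maxA] | [sAP abA maxA]]; split=> //.
  by move=> B sBP abB; move/implyP: (maxA B) => ->; rewrite // sBP.
by apply/forallP=> B; apply/implyP=> /andP[]; apply: maxA.
Qed.

Lemma Thompson_J_sub P : Thompson_J P \subset P.
Proof. by rewrite gen_subG; apply/bigcupsP=> A /max_abelianP[]. Qed.

Lemma sub_Thompson_J (P : {set gT}) A : max_abelian P A -> A \subset Thompson_J P.
Proof. by move=> mA; rewrite sub_gen // (bigcup_max A). Qed.

Lemma max_abelian_exists P : exists A, max_abelian P A.
Proof.
pose ab B := (B \subset P) && abelian B.
have ab1 : ab 1%G by rewrite /ab sub1G abelian1.
case: (arg_maxnP (fun B : {group gT} => #|B|) ab1) => A /andP[sAP abA] maxA.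
exists A; apply/max_abelianP; split=> // B sBP abB; apply: maxA.
by rewrite /ab sBP.
Qed.

Lemma Thompson_J_eq1 P : Thompson_J P = 1 -> P :=: 1.
Proof.
move=> J1; have [A mA] := max_abelian_exists P.
have A1 : A :=: 1 by apply/trivgP; rewrite -J1 sub_Thompson_J.
have /max_abelianP[_ _ maxA] := mA.
apply/trivgP/subsetP=> x Px; rewrite inE -order_eq1 eqn_leq order_gt0 andbT.
have := maxA <[x]>%G; rewrite /= cycle_subG cycle_abelian => /(_ Px isT).
by rewrite A1 cards1.
Qed.

(** [U] contains every abelian subgroup of [P] of largest order, so the largest orders in [P] and
    [U] agree. With [U = 'O_p(G)] this makes [Thompson_J P] normal in [G]. *)
Lemma Thompson_J_subgroup P U :
  U \subset P -> Thompson_J P \subset U -> Thompson_J P = Thompson_J U.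
Proof.
move=> sUP sJU; congr <<_>>; apply: eq_bigl => A.
apply/max_abelianP/max_abelianP => [[sAP abA maxA] | [sAU abA maxA]]; split=> //.
- by apply: subset_trans sJU; apply: sub_Thompson_J; apply/max_abelianP.
- by move=> B sBU; apply: maxA; apply: subset_trans sUP.
- exact: subset_trans sUP.
have [A0 mA0] := max_abelian_exists P; have /max_abelianP[_ abA0 maxA0] := mA0.
move=> B sBP abB; apply: leq_trans (maxA0 B sBP abB) _; apply: maxA => //.
exact: subset_trans (sub_Thompson_J mA0) sJU.
Qed.

End ThompsonSubgroup.

Lemma injm_max_abelian (aT rT : finGroupType) (D P A : {group aT})
    (f : {morphism D >-> rT}) :
  'injm f -> P \subset D -> max_abelian P A -> max_abelian (f @* P) (f @* A)%G.
Proof.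
move=> injf sPD /max_abelianP[sAP abA maxA]; apply/max_abelianP; split=> /=.
- exact: morphimS.
- exact: morphim_abelian.
move=> B sBP abB.
have sBfD : B \subset f @* D := subset_trans sBP (morphimS f sPD).
rewrite card_injm ?(subset_trans sAP) // -(morphpreK sBfD) card_injm ?subsetIl //.
apply: maxA; last by rewrite -(injm_abelian injf) ?subsetIl // morphpreK.
by rewrite -(injmK injf sPD) morphpreS.
Qed.

Lemma injm_Thompson_J (aT rT : finGroupType) (D P : {group aT})
    (f : {morphism D >-> rT}) :
  'injm f -> P \subset D -> f @* Thompson_J P = Thompson_J (f @* P).
Proof.
move=> injf sPD; have sJD := subset_trans (Thompson_J_sub P) sPD.
apply/eqP; rewrite eqEsubset; apply/andP; split.
  rewrite morphim_gen; last by apply: subset_trans sJD; apply: subset_gen.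
  rewrite gen_subG; apply/subsetP=> _ /morphimP[x Dx /bigcupP[A mA Ax] ->].
  apply: (subsetP (sub_Thompson_J (injm_max_abelian injf sPD mA))).
  exact: mem_morphim.
rewrite gen_subG; apply/bigcupsP=> B mB; have /max_abelianP[sBP _ _] := mB.
have sfPD : f @* P \subset f @* D := morphimS f sPD.
have mB' := injm_max_abelian (injm_invm injf) sfPD mB.
rewrite /= morphim_invm // in mB'.
have := sub_Thompson_J mB'; rewrite /= => sBJ.
have sBfD : B \subset f @* D := subset_trans sBP sfPD.
by have := morphimS f sBJ; rewrite morphim_invmE morphpreK.
Qed.

Section ThompsonJ_norm.
Variable gT : finGroupType.
Implicit Types P : {group gT}.

Lemma Thompson_JJ P x : Thompson_J (P :^ x) = Thompson_J P :^ x.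
Proof.
have := injm_Thompson_J (injm_conj [set: gT] x) (subsetT P).
by rewrite !morphim_conj !setTI.
Qed.

Lemma norm_Thompson_J P : 'N(P) \subset 'N(Thompson_J P).
Proof.
apply/subsetP=> x Nx; rewrite inE -Thompson_JJ.
by rewrite (normP Nx).
Qed.
End ThompsonJ_norm.

(** * Groups with trivial p'-core *)

Section PConstraint.
Variable p : nat.

Lemma pcore_p'_normal_pgroup (gT : finGroupType) (G N : {group gT}) :
  'O_p^'(G) = 1 -> N <| G -> p_nilpotent p N -> N \subset 'O_p(G).
Proof.
move=> O1 nNG nilN; apply: (pcore_max _ nNG); apply: p_nilpotent_pgroup nilN _.
by apply/trivgP; rewrite -O1 pcore_max ?pcore_pgroup // gFnormal_trans.
Qed.

(** The Sylow subgroup [U :&: 'C_M(U)] of ['C_M(U)] is central, so a Schur-Zassenhaus complement to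
    it is normal. Thus ['C_M(U)] is [p]-nilpotent and normal in [G], hence a [p]-group, hence inside
    the Sylow subgroup [U]. *)
Lemma cent_pcore_sub (gT : finGroupType) (G M U : {group gT}) :
    'O_p^'(G) = 1 -> M <| G -> U <| G -> p.-Sylow(M) U ->
  'C_M(U) \subset U.
Proof.
move=> O1 nMG nUG sylU; have [sUM pU p'MU] := and3P sylU.
pose N := 'C_M(U)%G.
have nUM : U <| M := normalS sUM (normal_sub nMG) nUG.
have nNG : N <| G.
  have nCG : G \subset 'N('C_M(U)) by rewrite normsI ?norms_cent ?normal_norm.
  by rewrite /normal nCG subIset ?(normal_sub nMG).
have sylZ : p.-Sylow(N) (U :&: N)%G by apply: (setI_normal_Hall nUM sylU); apply: subsetIl.
have nZN : U :&: N <| N by rewrite /normal subsetIr normsI ?normG // cents_norm ?subsetIr.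
have cZN : N \subset 'C(U :&: N) by rewrite (subset_trans (subsetIr M _)) ?centS ?subsetIl.
suffices pnN : p_nilpotent p N.
  rewrite (sub_normal_Hall sylU nUM) ?subsetIl //.
  by rewrite (pgroupS (pcore_p'_normal_pgroup O1 nNG pnN)) ?pcore_pgroup.
have /splitsP[H /complP[tiZH defN]] := SchurZassenhaus_split (pHall_Hall sylZ) nZN.
have sHN : H \subset N by rewrite -defN mulG_subr.
have nHN : H <| N.
  rewrite /normal sHN -defN mulG_subG normG andbT cents_norm // centsC.
  exact: subset_trans sHN cZN.
have oN : #|N| = (#|(U :&: N)%G| * #|H|)%N by rewrite -defN TI_cardMg.
apply/p_nilpotentP; exists H; split=> //.
  have /and3P[_ _] := sylZ; rewrite -divgS ?subsetIr // oN mulKn ?cardG_gt0 //.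
have /and3P[_ pZ _] := sylZ.
by rewrite /pgroup card_quotient ?normal_norm // -divgS // oN mulnK ?cardG_gt0.
Qed.
End PConstraint.

Definition Thompson_hyp (p : nat) (gT : finGroupType) (G P : {set gT}) :=
  p_nilpotent p 'C_G('Ohm_1('Z(P))) && p_nilpotent p 'N_G(Thompson_J P).

Section ThompsonComplement.
Variables (p : nat) (gT : finGroupType).
Implicit Types G H M P U : {group gT}.

Lemma Thompson_hypS G H P :
  H \subset G -> Thompson_hyp p G P -> Thompson_hyp p H P.
Proof.
move=> sHG /andP[nilC nilN]; apply/andP; split.
  by apply: p_nilpotentS nilC; rewrite setSI.
by apply: p_nilpotentS nilN; rewrite setSI.
Qed.

(** The quotient map is injective on [P], hence commutes with both characteristic subgroups. The
    centralizer lifts by coprime action, the normalizer by the Frattini argument in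
    [M <*> Thompson_J P]. *)
Lemma Thompson_hyp_p'quotient G M P :
    M <| G -> p^'.-group M -> p.-Sylow(G) P -> Thompson_hyp p G P ->
  Thompson_hyp p (G / M) (P / M).
Proof.
move=> nMG p'M sylP /andP[nilC nilN]; have [sPG pP _] := and3P sylP.
have [sMG nMGn] := andP nMG.
have nMP : P \subset 'N(M) := subset_trans sPG nMGn.
have coPM : coprime #|P| #|M| := pnat_coprime pP p'M.
pose f := restrm_morphism nMP (coset_morphism M).
have injf : 'injm f by rewrite ker_restrm ker_coset (coprime_TIg coPM).
have fE (A : {set gT}) : A \subset P -> f @* A = A / M.
  by move=> sAP; rewrite morphim_restrm (setIidPr sAP).
have sZP : 'Z(P) \subset P := center_sub P.
have sOP : 'Ohm_1('Z(P)) \subset P := subset_trans (Ohm_sub 1 _) sZP.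
have sJP := Thompson_J_sub P.
have ZE : 'Ohm_1('Z(P / M)) = 'Ohm_1('Z(P)) / M.
  by rewrite -(fE P) // -injm_center // -injm_Ohm // fE.
have JE : Thompson_J (P / M) = Thompson_J P / M.
  by rewrite -(fE P) // -injm_Thompson_J // fE.
rewrite /Thompson_hyp ZE JE; apply/andP; split.
  rewrite -strongest_coprime_quotient_cent.
  - by apply: p_nilpotent_quotient nilC; rewrite subIset ?nMGn.
  - exact: subset_trans sOP nMP.
  - by rewrite subIset ?sMG.
  - apply: coprimeSg (subsetIl _ _) _; rewrite coprime_sym.
    exact: coprimeSg sOP coPM.
  - by rewrite (solvableS sOP (pgroup_sol pP)) orbT.
pose J := Thompson_J_group P.
have nMJ : J \subset 'N(M) := subset_trans sJP nMP.
have sylJ : p.-Sylow(M <*> J) J.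
  rewrite pHallE joing_subr /= norm_joinEr //=.
  rewrite TI_cardMg; last by rewrite setIC coprime_TIg // (coprimeSg sJP).
  rewrite partnM ?cardG_gt0 // (part_p'nat p'M) mul1n eq_sym.
  by apply/eqP; apply: part_pnat_id; apply: pgroupS sJP pP.
have nMMJ : M <| M <*> J by rewrite normalYl.
rewrite (_ : Thompson_J P / M = (M <*> J) / M); last by rewrite quotientYidl.
rewrite -quotient_subnormG //; pose N := 'N_G(M <*> J)%G.
change (p_nilpotent p (N / M)).
have nMJN : M <*> J <| N.
  by rewrite /normal subsetIr subsetI normG join_subG sMG (subset_trans sJP sPG).
have defN := Frattini_arg nMJN sylJ.
have nMN : N \subset 'N(M) by rewrite subIset ?nMGn.
have sJN : J \subset 'N_N(J).
  rewrite subsetI normG andbT subsetI (subset_trans sJP sPG) /=.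
  by rewrite (subset_trans (joing_subr M J)) ?normG.
have defN' : M * J * 'N_N(J) = N by rewrite -(norm_joinEr nMJ); exact: defN.
have <- : 'N_N(J) / M = N / M.
  have sNM : M * J * 'N_N(J) \subset M * 'N_N(J) by rewrite -mulgA (mulSGid sJN).
  rewrite defN' in sNM.
  by apply/eqP; rewrite eqEsubset quotientS ?subsetIl // quotientSK.
apply: p_nilpotent_quotient; first by rewrite subIset ?nMN.
by apply: p_nilpotentS nilN; rewrite setSI ?subsetIl.
Qed.

(* Among the nontrivial p-subgroups whose normalizer is not p-nilpotent, one for which
   that normalizer has the largest p-part is normal in [G]. *)
Lemma Thompson_pcore_nontrivial G P :
    (forall H R : {group gT}, H \proper G -> p.-Sylow(H) R -> Thompson_hyp p H R ->
       p_nilpotent p H) ->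
    p.-Sylow(G) P -> Thompson_hyp p G P -> ~~ p_nilpotent p G ->
  'O_p(G) != 1.
Proof.
move=> IH sylP /andP[nilZ nilJ] nnil; have [sPG pP _] := and3P sylP.
pose bad (X : {group gT}) :=
  [&& X \subset G, p.-group X, X :!=: 1 & ~~ p_nilpotent p 'N_G(X)].
have [X0 badX0] : exists X0, bad X0.
  case: (pickP bad) => [X bX | none]; first by exists X.
  case/negP: nnil; apply: Frobenius_normal_p_complement => X sXG pX ntX.
  by have /negbT := none X; rewrite /bad sXG pX ntX negbK.
case: (arg_maxnP (fun X : {group gT} => (#|'N_G(X)|`_p)%N) badX0) => X1 badX1 maxX1.
have [S1 sylS1] := Sylow_exists p 'N_G(X1).
have [sS1N pS1 _] := and3P sylS1.
have [g Gg sSP] := Sylow_Jsub sylP (subset_trans sS1N (subsetIl _ _)) pS1.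
pose X := (X1 :^ g)%G; pose S := (S1 :^ g)%G.
have NJ : 'N_G(X) = 'N_G(X1) :^ g by rewrite conjIg -normJ (conjGid Gg).
have sylS : p.-Sylow('N_G(X)) S by rewrite NJ pHallJ2.
have [sXG pX ntX nilN] : [/\ X \subset G, p.-group X, X :!=: 1 & ~~ p_nilpotent p 'N_G(X)].
  case/and4P: badX1 => sX1G pX1 ntX1 nilN1; split.
  - by rewrite -(conjGid Gg) conjSg.
  - by rewrite pgroupJ.
  - by rewrite -!cardG_gt1 cardJg cardG_gt1 in ntX1 *.
  by rewrite NJ p_nilpotentJ.
have maxX Y : bad Y -> (#|'N_G(Y)|`_p)%N <= #|S|.
  by move=> badY; rewrite (card_Hall sylS) /= NJ cardJg; apply: maxX1.
have nXN : X <| 'N_G(X) by rewrite /normal subsetI sXG normG subsetIr.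
have [defG | prN] := eqVproper (subsetIl G 'N(X)).
  rewrite defG in nXN; apply: contraNneq ntX => O1; rewrite -subG1 -O1.
  exact: pcore_max.
have [sSN pS _] := and3P sylS.
have sXS : X \subset S := normal_sub_max_pgroup (Hall_max sylS) pX nXN.
case/negP: nilN; apply: (IH _ _ prN sylS); apply/andP; split.
  (* ['Z(P)] centralizes [X] and [S], so it lies in the Sylow subgroup [S] of ['N_G(X)]. Hence the
     centralizer condition for [S] follows from that for [P]. *)
  have cZP : 'Z(P) \subset 'C(P) := subsetIr _ _.
  have sZS : 'Z(P) \subset S.
    apply: (norm_sub_max_pgroup (Hall_max sylS)); first exact: pgroupS (center_sub P) pP.
      rewrite subsetI (subset_trans (center_sub P) sPG) /= cents_norm //.
      by rewrite (subset_trans cZP) ?centS ?(subset_trans sXS).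
    by rewrite cents_norm // (subset_trans cZP) ?centS.
  have sZZ : 'Z(P) \subset 'Z(S) by rewrite subsetI sZS (subset_trans cZP) ?centS.
  by apply: p_nilpotentS nilZ; rewrite setISS ?subsetIl ?centS ?OhmS.
have [eqSP | prSP] := eqVproper sSP.
  by rewrite /= eqSP; apply: p_nilpotentS nilJ; rewrite setSI ?subsetIl.
(* Otherwise [Thompson_J S] is another bad subgroup, and its normalizer contains ['N_P(S)], a
   [p]-group larger than [S]; this contradicts the choice of [X1]. *)
apply/idPn=> nilJS.
have badJ : bad (Thompson_J_group S).
  rewrite /bad /= (subset_trans (Thompson_J_sub S)) ?(subset_trans sSP) //=.
  rewrite (pgroupS (Thompson_J_sub S)) //=; apply/andP; split.
    apply: contraNneq ntX => /(@Thompson_J_eq1 _ S) S1'.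
    by rewrite -subG1 -S1'.
  by apply: contra nilJS; apply: p_nilpotentS; rewrite setSI ?subsetIl.
have prSN := nilpotent_proper_norm (pgroup_nil pP) prSP.
have pNP : p.-group 'N_P(S) by rewrite (pgroupS _ pP) ?subsetIl.
have sNJ : 'N_P(S) \subset 'N_G(Thompson_J S).
  by rewrite setISS ?norm_Thompson_J.
have [R sylR sNR] := Sylow_superset sNJ pNP.
have := leq_trans (proper_card prSN) (subset_leq_card sNR).
by rewrite (card_Hall sylR) ltnNge (maxX _ badJ).
Qed.

(** A nontrivial normal subgroup of [P / 'O_p(G)] has a preimage that is a [p]-group not normal in
    [G]. The normalizer of this preimage is proper and contains [P], hence is [p]-nilpotent by
    [IH]. *)
Lemma Thompson_hyp_pcore_quotient G P :
    (forall H R : {group gT}, H \proper G -> p.-Sylow(H) R -> Thompson_hyp p H R ->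
       p_nilpotent p H) ->
    p.-Sylow(G) P -> Thompson_hyp p G P -> ~~ p_nilpotent p G ->
  Thompson_hyp p (G / 'O_p(G)) (P / 'O_p(G)).
Proof.
move=> IH sylP hypG nnil; have [sPG pP _] := and3P sylP.
set U := 'O_p(G)%G; have nUG : U <| G := pcore_normal p G.
have sUP : U \subset P := pcore_sub_Hall sylP.
have nUP : U <| P := normalS sUP sPG nUG.
have key (Wb : {group coset_of U}) :
    Wb :!=: 1 -> Wb \subset P / U -> P / U \subset 'N(Wb) -> p_nilpotent p 'N_(G / U)(Wb).
  move=> ntW sWP nWP; have [W defW sUW sWPp] := inv_quotientS nUP sWP.
  have nUW : U <| W := normalS sUW (subset_trans sWPp sPG) nUG.
  rewrite defW -quotient_subnormG //.
  apply: p_nilpotent_quotient; first by rewrite subIset ?(normal_norm nUG).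
  have prN : 'N_G(W) \proper G.
    rewrite properE subsetIl subsetI subxx /=; apply: contra ntW => nWG.
    rewrite defW -subG1 quotient_sub1 ?normal_norm // pcore_max ?(pgroupS sWPp) //.
    by rewrite /normal nWG (subset_trans sWPp).
  have sPN : P \subset 'N_G(W).
    rewrite subsetI sPG /= -(quotientGK nUW) -defW.
    exact: norm_quotient_pre (normal_norm nUP) nWP.
  apply: IH prN (pHall_subl sPN (subsetIl _ _) sylP) _.
  exact: Thompson_hypS (subsetIl _ _) hypG.
have ntPU : P / U != 1.
  rewrite -subG1 quotient_sub1 ?normal_norm //; apply: contra nnil => sPU.
  have defP : P :=: U by apply/eqP; rewrite eqEsubset sPU.
  case/andP: hypG => _; rewrite (setIidPl _) //.
  by apply: subset_trans (norm_Thompson_J P); rewrite defP normal_norm.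
have pPU : p.-group (P / U) := quotient_pgroup U pP.
apply/andP; split.
  apply: (@p_nilpotentS _ _ 'N_(G / U)('Ohm_1('Z(P / U)))).
    by rewrite setIS ?cent_sub.
  apply: key.
  - rewrite Ohm1_eq1; apply: contra ntPU => /eqP Z1.
    by apply/eqP; apply: trivg_center_pgroup pPU Z1.
  - exact: subset_trans (Ohm_sub 1 _) (center_sub _).
  by rewrite !gFnorm_trans ?normG.
apply: (key (Thompson_J_group [group of P / U])) => /=.
- by apply: contraNneq ntPU => /(@Thompson_J_eq1 _ [group of P / U]) ->.
- exact: Thompson_J_sub.
exact: subset_trans (normG _) (norm_Thompson_J [group of P / U]).
Qed.

End ThompsonComplement.

(** By the Frattini argument the normalizer of a Sylow [q]-subgroup of [K] has index dividing
    [#|K|], so it contains a Sylow [p]-subgroup of [G], which is conjugate to [P]. *)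
Lemma normal_p'Hall_Sylow_norm (p q : nat) (gT : finGroupType) (G K P : {group gT}) :
    p^'.-Hall(G) K -> K <| G -> p.-Sylow(G) P ->
  exists2 R : {group gT}, q.-Sylow(K) R & P \subset 'N(R).
Proof.
move=> hallK nKG sylP; have [sKG p'K pGK] := and3P hallK.
have [R0 sylR0] := Sylow_exists q K; pose N := 'N_G(R0)%G.
have defG : K * N = G := Frattini_arg nKG sylR0.
have sNG : N \subset G := subsetIl _ _.
have dvd_GN : #|G : N| %| #|K|.
  have oKN : (#|K| * #|N| = #|N| * #|G : N| * #|K :&: N|)%N.
    by rewrite mul_cardG defG Lagrange.
  by rewrite -(dvdn_pmul2r (cardG_gt0 N)) oKN mulnC dvdn_mulr.
have [T sylT] := Sylow_exists p N; have [sTN pT p'NT] := and3P sylT.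
have sylTG : p.-Sylow(G) T.
  rewrite /pHall (subset_trans sTN sNG) pT -(Lagrange_index sNG sTN) pnatM p'NT andbT.
  exact: pnat_dvd dvd_GN p'K.
have [x Gx defT] := Sylow_trans sylP sylTG.
exists (R0 :^ x^-1)%G.
  have Gx' : x^-1 \in G by rewrite groupV.
  have {1}<- : K :^ x^-1 = K by apply: (normsP (normal_norm nKG)).
  by rewrite pHallJ2.
by rewrite /= normJ -sub_conjg -defT (subset_trans sTN) ?subsetIr.
Qed.

Section ThompsonAbelianComplement.
Variables (p : nat) (gT : finGroupType).
Implicit Types G H M P U : {group gT}.

(** [Q] is the centre of a [P]-invariant Sylow [q]-subgroup of the [p']-core of [G / 'O_p(G)], for a
    prime [q] dividing the order of that core. *)
Lemma p_nilpotent_quotient_abelian_complement G P :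
    (forall H, H \proper G -> P \subset H -> p_nilpotent p H) ->
    p.-Sylow(G) P -> 'O_p^'(G) = 1 -> ~~ p_nilpotent p G ->
    p_nilpotent p (G / 'O_p(G)) ->
  exists Q : {group coset_of 'O_p(G)},
    [/\ Q <| G / 'O_p(G), abelian Q, p^'.-group Q & Q * (P / 'O_p(G)) = G / 'O_p(G)].
Proof.
move=> IH sylP O1 nnil; have [sPG pP _] := and3P sylP.
set U := 'O_p(G)%G; have nUG : U <| G := pcore_normal p G.
have pU : p.-group U := pcore_pgroup p G.
rewrite p_nilpotentE; set Gb := (G / U)%G; set K := 'O_p^'(Gb)%G => hallK.
have nKG : K <| Gb := pcore_normal _ _.
have [sKG p'K _] := and3P hallK.
have sUP : U \subset P := pcore_sub_Hall sylP.
have nUP : U <| P := normalS sUP sPG nUG.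
have sylPb : p.-Sylow(Gb) (P / U)%G.
  by apply: quotient_pHall sylP; apply: normal_norm.
have [K1 | [q q_pr q_dv_K]] := trivgVpdiv K.
  case/negP: nnil; apply: p_nilpotent_nil; apply: (@pgroup_nil _ p).
  rewrite -(pquotient_pgroup pU) ?normal_norm //.
  by apply: p_nilpotent_pgroup K1; rewrite p_nilpotentE.
have [R sylR nRP] := normal_p'Hall_Sylow_norm q hallK nKG sylPb.
have [sRK qR _] := and3P sylR.
have ntR : R :!=: 1.
  rewrite -cardG_gt1 (card_Hall sylR) p_part_gt1.
  by rewrite mem_primes q_pr cardG_gt0.
pose Q := 'Z(R)%G.
have ntQ : Q :!=: 1 by apply: contra ntR => /eqP/(trivg_center_pgroup qR)->.
have nQP : P / U \subset 'N(Q) by apply: gFnorm_trans.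
have sQK : Q \subset K := subset_trans (center_sub R) sRK.
have p'Q : p^'.-group Q := pgroupS sQK p'K.
have [sQG sPbG] : Q \subset Gb /\ P / U \subset Gb.
  by rewrite (subset_trans sQK) ?quotientS.
have sLG : (Q <*> (P / U))%G \subset G / U by rewrite join_subG sQG.
have [L defL sUL sLGp] := inv_quotientS nUG sLG.
have nUL : U <| L := normalS sUL sLGp nUG.
have sPL : P \subset L.
  by rewrite -(quotientSGK _ sUL) ?(normal_norm nUP) // -defL joing_subr.
(* If [L] were proper, it would be [p]-nilpotent. Its [p']-core centralizes [U], so it is trivial by
   [cent_pcore_sub]; then [L] is a [p]-group and its image cannot contain [Q]. *)
have [eqLG | prL] := eqVproper sLGp; last first.
  have nilL := IH L prL sPL.
  have [M defM sUM nMG] := inv_quotientN nUG nKG.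
  have nUM : U <| M := normalS sUM (normal_sub nMG) nUG.
  have sylU : p.-Sylow(M) U.
    rewrite /pHall sUM pU -card_quotient ?normal_norm // -defM.
    exact: p'K.
  have sOM : 'O_p^'(L) \subset M.
    have sOL := pcore_sub p^' L.
    rewrite -(quotientSGK _ sUM); last first.
      exact: subset_trans sOL (normal_norm nUL).
    rewrite -defM (sub_Hall_pcore hallK) ?quotient_pgroup ?pcore_pgroup //.
    by rewrite quotientS ?(subset_trans sOL).
  have sOU : 'O_p^'(L) \subset U.
    apply: subset_trans (cent_pcore_sub O1 nMG nUG sylU).
    by rewrite subsetI sOM (pcore_p'_sub_cent nUL pU).
  have O1L : 'O_p^'(L) = 1.
    apply/trivgP; rewrite -(coprime_TIg (pnat_coprime pU (pcore_pgroup p^' L))).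
    by rewrite subsetI sOU subxx.
  have sQL : Q \subset L / U by rewrite -defL joing_subl.
  case/eqP: ntQ; apply/trivgP.
  rewrite -(coprime_TIg (pnat_coprime (quotient_pgroup U (p_nilpotent_pgroup nilL O1L)) p'Q)).
  by rewrite subsetI subxx sQL.
have defGb : Q <*> (P / U) = Gb by rewrite [LHS]defL eqLG.
have defGb' : Q * (P / U) = Gb by rewrite -defGb norm_joinEr.
exists Q; rewrite center_abelian p'Q; split=> //.
have nQL : Q <*> (P / U) \subset 'N(Q) by rewrite join_subG normG.
by rewrite defGb in nQL; apply/andP.
Qed.

Lemma Thompson_abelian_complement G P :
    odd p -> p.-Sylow(G) P -> 'O_p^'(G) = 1 -> Thompson_hyp p G P ->
    (exists Q : {group coset_of 'O_p(G)},
      [/\ Q <| G / 'O_p(G), abelian Q, p^'.-group Q & Q * (P / 'O_p(G)) = G / 'O_p(G)]) ->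
  p_nilpotent p G.
Proof.
move=> odd_p sylP O1 /andP[nilC nilN]; have [sPG pP _] := and3P sylP.
set U := 'O_p(G)%G; have nUG : U <| G := pcore_normal p G.
have pU : p.-group U := pcore_pgroup p G.
have sUP : U \subset P := pcore_sub_Hall sylP.
case=> Q [nQG abQ p'Q defGb].
have pGQ : p.-group (G / U / Q) by rewrite -[X in X / Q]defGb quotientMidl !quotient_pgroup.
have nUP : U <| P := normalS sUP sPG nUG.
have [M defM sUM nMG] := inv_quotientN nUG nQG.
have sMG := normal_sub nMG.
have nUM : U <| M := normalS sUM sMG nUG.
have Ob1 : 'O_p(G / U) = 1 := trivg_pcore_quotient p G.
have sylU : p.-Sylow(M) U.
  by rewrite /pHall sUM pU -card_quotient ?normal_norm // -defM.
have hallQ : p^'.-Hall(G / U) Q.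
  rewrite /pHall (normal_sub nQG) p'Q pnatNK -card_quotient ?normal_norm //.
(* The image of such a [C] meets the Hall subgroup [Q] trivially, so it is a normal [p]-subgroup of
   [G / U], whose [p]-core is trivial. *)
have p_norm_cent (C : {group gT}) : C <| G -> C :&: M \subset U -> C \subset U.
  move=> nCG sCMU; have sCG := normal_sub nCG.
  have nUC : C \subset 'N(U) := subset_trans sCG (normal_norm nUG).
  rewrite -quotient_sub1 // -Ob1 pcore_max ?quotient_normal //.
  have hallC := setI_normal_Hall nQG hallQ (quotientS U sCG).
  have tiQC : Q :&: (C / U) = 1.
    rewrite defM -quotientGI // setIC; apply/trivgP; rewrite quotient_sub1 //.
    by rewrite subIset // nUC.
  have /and3P[_ _] := hallC; rewrite /= tiQC indexg1.
  by rewrite pnatNK.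
have CU : 'C_G(U) \subset U.
  apply: p_norm_cent.
    by rewrite /normal subsetIl normsI ?normG ?norms_cent ?normal_norm.
  apply: subset_trans (cent_pcore_sub O1 nMG nUG sylU).
  by rewrite setIC setIS ?subsetIr.
pose V := 'Ohm_1('Z(U))%G.
have abelV : p.-abelem V.
  by rewrite Ohm1_abelem ?center_abelian // (pgroupS (center_sub U)).
have [pV abV _] := and3P abelV.
have sZU : 'Z(P) \subset U.
  apply: subset_trans CU; rewrite subsetI (subset_trans (center_sub P)) //=.
  by rewrite (subset_trans (subsetIr _ _)) ?centS.
have sZV : 'Ohm_1('Z(P)) \subset V.
  by rewrite OhmS // subsetI sZU (subset_trans (subsetIr _ _)) ?centS.
have sVU : V \subset U by apply: subset_trans (Ohm_sub 1 _) (center_sub _).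
have cUV : U \subset 'C(V).
  by rewrite centsC (subset_trans (Ohm_sub 1 _)) // subsetIr.
have nVG : V <| G by rewrite !gFnormal_trans.
have CV : 'C_G(V) \subset U.
  have nCG : 'C_G(V) <| G.
    by rewrite /normal subsetIl normsI ?normG ?norms_cent ?normal_norm.
  have nilCV : p_nilpotent p 'C_G(V) by apply: p_nilpotentS nilC; rewrite setIS ?centS.
  exact: (pcore_p'_normal_pgroup O1 nCG nilCV).
(* If [U] contains [Thompson_J P], this equals [Thompson_J U] and is normal in [G], so [nilN] is the
   claim. *)
have [sJU | nJU] := boolP (Thompson_J P \subset U).
  have nJG : G \subset 'N(Thompson_J P).
    rewrite (Thompson_J_subgroup sUP sJU).
    exact: subset_trans (normal_norm nUG) (norm_Thompson_J U).
  by rewrite (setIidPl nJG) in nilN.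
have [A mA nAU] : exists2 A : {group gT}, max_abelian P A & ~~ (A \subset U).
  case: (pickP [pred A : {group gT} | max_abelian P A && ~~ (A \subset U)]) => [A /andP[]|none].
    by exists A.
  case/negP: nJU; rewrite gen_subG; apply/bigcupsP=> A mA.
  by have /negbT := none A; rewrite /= mA negbK.
have /max_abelianP[sAP abA maxA] := mA.
have sAG := subset_trans sAP sPG.
have nVA : A \subset 'N(V) := subset_trans sAG (normal_norm nVG).
have cVA_sub (X : {set gT}) : X \subset G -> X \subset 'C(V) -> X \subset U.
  by move=> sXG cX; apply: subset_trans CV; rewrite subsetI sXG.
have ncA : ~~ (A \subset 'C(V)) by apply: contra nAU; apply: cVA_sub.
(* [V <*> 'C_A(V)] is abelian, so its order is at most [#|A|] by maximality, and [V :&: 'C_A(V)]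
   lies in ['C_V(A)]. *)
have leA : #|'C_A(V)| * #|V| <= #|A| * #|'C_V(A)|.
  have nVC : 'C_A(V) \subset 'C(V) := subsetIr _ _.
  rewrite mulnC mul_cardG leq_mul //.
    rewrite -cent_joinEr //; apply: maxA.
      by rewrite join_subG (subset_trans sVU sUP) subIset ?sAP.
    by rewrite abelianY abV (abelianS (subsetIl _ _) abA) nVC.
  apply: subset_leq_card; rewrite subsetI subsetIl.
  by rewrite subIset // (subset_trans (subsetIl _ _)) ?orbT.
have [B [sBA ncB quadB]] := quadratic_offender pV (pgroupS sAP pP) abV abA nVA ncA leA.
have [b Bb ncb] := subsetPn ncB.
case/negP: ncb.
have sBG := subset_trans sBA sAG; have Gb := subsetP sBG b Bb.
have nVx x : x \in G -> x \in 'N(V) by apply: subsetP (normal_norm nVG) x.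
have nUx x : x \in G -> x \in 'N(U) by apply: subsetP (normal_norm nUG) x.
(* As [M / U] is abelian, [y] commutes modulo [U], hence modulo ['C(V)], with its conjugates by [b]
   and [b^-1], as the quadratic lemma requires. *)
have comm_b y : y \in M -> p^'.-elt y -> [~ b, y] \in U.
  move=> My p'y; have Gy := subsetP sMG y My.
  have yM z : z \in G -> [~ y, y ^ z] \in 'C(V).
    move=> Gz; apply: (subsetP cUV).
    have Myz : y ^ z \in M by rewrite memJ_norm // (subsetP (normal_norm nMG)).
    have Gyz := subsetP sMG _ Myz.
    rewrite coset_idr ?groupR ?nUx //= morphR ?nUx //; apply/eqP/commgP.
    by apply: (centsP abQ); rewrite defM mem_quotient.
  apply: (subsetP CV); rewrite inE groupR //=.
  apply: (quadratic_commutator_cent odd_p abelV) => //; rewrite ?nVx ?yM ?groupV //.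
  by move=> v Vv; apply: quadB.
have cQb : coset U b \in 'C(Q).
  apply/centP=> yb Qyb; have : yb \in M / U by rewrite -defM.
  case/morphimP=> y Ny My defyb.
  have p'yb : p^'.-elt yb := mem_p_elt p'Q Qyb.
  have -> : yb = coset U y.`_p^'.
    by rewrite -(constt_p_elt p'yb) defyb morph_constt.
  have Gy := subsetP sMG y My.
  apply/commgP; rewrite -morphR ?groupX ?nUx //.
  by apply/eqP; apply: coset_id; rewrite comm_b ?groupX ?p_elt_constt.
apply: (subsetP cUV); suffices: coset U b \in 'O_p(G / U).
  by rewrite Ob1 => /set1P/coset_idr; apply; apply: nUx.
have Pb := subsetP (subset_trans sBA sAP) b Bb.
(* This [p]-group is normalized by [Q] and by [P / U], so it is normal in [G / U]. *)
have sC : 'C_(P / U)(Q) \subset 'O_p(G / U).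
  apply: pcore_max; first by rewrite (pgroupS (subsetIl _ _)) ?quotient_pgroup.
  rewrite /normal subIset ?quotientS //= -defGb mulG_subG; apply/andP; split.
    by rewrite cents_norm // centsC subsetIr.
  rewrite normsI ?normG // norms_cent //.
  exact: subset_trans (quotientS U sPG) (normal_norm nQG).
by apply: (subsetP sC); rewrite inE mem_quotient.
Qed.

End ThompsonAbelianComplement.

Theorem Thompson_normal_p_complement p (gT : finGroupType) (G P : {group gT}) :
    odd p -> p.-Sylow(G) P -> p_nilpotent p 'C_G('Ohm_1('Z(P))) ->
    p_nilpotent p 'N_G(Thompson_J P) ->
  p_nilpotent p G.
Proof.
move=> odd_p sylP nilC nilN; have hypG : Thompson_hyp p G P by apply/andP.
move: sylP hypG {nilC nilN}; have [n] := ubnP #|G|.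
elim: n gT G P => // n IHn gT G P /ltnSE leGn sylP hypG; have [sPG pP _] := and3P sylP.
have [O1 | ntO] := eqVneq 'O_p^'(G) 1; last first.
  have nOG := pcore_normal p^' G; have p'O := pcore_pgroup p^' G.
  apply: (p_nilpotent_p'ext nOG p'O); apply: (IHn _ _ (P / 'O_p^'(G))%G).
  - exact: leq_trans (ltn_quotient ntO (pcore_sub _ _)) leGn.
  - by apply: quotient_pHall sylP; apply: subset_trans sPG (normal_norm nOG).
  exact: Thompson_hyp_p'quotient.
have IHG (H R : {group gT}) :
    H \proper G -> p.-Sylow(H) R -> Thompson_hyp p H R -> p_nilpotent p H.
  by move=> prH; apply: IHn; apply: leq_trans (proper_card prH) leGn.
apply/idPn=> nnil; have ntU := Thompson_pcore_nontrivial IHG sylP hypG nnil.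
case/negP: (nnil); apply: (Thompson_abelian_complement odd_p sylP O1 hypG).
apply: (p_nilpotent_quotient_abelian_complement _ sylP O1 nnil) => [H prH sPH | ].
  apply: (IHG _ _ prH (pHall_subl sPH (proper_sub prH) sylP)).
  exact: Thompson_hypS (proper_sub prH) hypG.
have nUG := pcore_normal p G.
apply: (IHn _ _ (P / 'O_p(G))%G).
- exact: leq_trans (ltn_quotient ntU (pcore_sub _ _)) leGn.
- by apply: quotient_pHall sylP; apply: subset_trans sPG (normal_norm nUG).
exact: Thompson_hyp_pcore_quotient.
Qed.

(** * Fixed-point-free automorphisms of prime order *)

Section FixedPointFree.
Variable gT : finGroupType.
Implicit Types (x y g : gT) (G H N P V : {group gT}).

(** A fixed-point-free automorphism is encoded as conjugation by [x]. Since [[~ g, x] = g^-1 * g ^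
    x], equal commutators make [g * h^-1] a fixed point. *)
Lemma fpf_commg_inj G x g h :
  'C_G[x] = 1 -> g \in G -> h \in G -> [~ g, x] = [~ h, x] -> g = h.
Proof.
move=> CG1 Gg Gh eq_gh; apply/eqP; rewrite eq_mulgV1 -in_set1; rewrite -[[set 1]]CG1.
rewrite inE groupM ?groupV //=; apply/cent1P/commgP/conjg_fixP.
rewrite conjMg conjVg; move: eq_gh; rewrite !commgEl => eq_gh.
by rewrite -[g ^ x](mulKVg g) eq_gh mulgA mulgK.
Qed.

Lemma fpf_commg_surj G x g :
  x \in 'N(G) -> 'C_G[x] = 1 -> g \in G -> exists2 h, h \in G & g = [~ h, x].
Proof.
move=> nGx CG1 Gg.
have sub : [set [~ h, x] | h in G] \subset G.
  apply/subsetP=> _ /imsetP[h Gh ->].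
  by rewrite commgEl groupM ?groupV ?memJ_norm.
have : [set [~ h, x] | h in G] == G :> {set gT}.
  rewrite eqEcard sub card_in_imset ?leqnn // => h k Gh Gk /= eq_hk.
  exact: fpf_commg_inj CG1 Gh Gk eq_hk.
by move/eqP/setP/(_ g); rewrite Gg => /imsetP[h Gh ->]; exists h.
Qed.

(** If the coset of [g] is fixed, [[~ g, x]] lies in [N], so it equals [[~ n, x]] for some [n] in
    [N], and [g = n]. *)
Lemma fpf_quotient G N x :
    N <| G -> x \in 'N(N) -> 'C_G[x] = 1 -> 'C_(G / N)[coset N x] = 1.
Proof.
move=> nNG nNx CG1; have sNG := normal_sub nNG.
have CN1 : 'C_N[x] = 1 by apply/trivgP; rewrite -CG1 setSI.
apply/trivgP/subsetP=> _ /setIP[/morphimP[g Ng Gg ->] /cent1P cgx].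
have Ngx : [~ g, x] \in N.
  rewrite coset_idr ?groupR //= morphR //; apply/eqP/commgP; exact: cgx.
have [n Nn eqn] := fpf_commg_surj nNx CN1 Ngx.
rewrite (fpf_commg_inj CG1 Gg (subsetP sNG n Nn) eqn) inE; apply/eqP.
exact: coset_id.
Qed.

(** If [P :^ x = P :^ g] and [g = [~ h, x]], the conjugate of [P] by [h^-1] is invariant under
    [x]. *)
Lemma fpf_Sylow p G x :
  x \in 'N(G) -> 'C_G[x] = 1 -> exists2 P : {group gT}, p.-Sylow(G) P & x \in 'N(P).
Proof.
move=> nGx CG1; have [P sylP] := Sylow_exists p G.
have sylPx : p.-Sylow(G) (P :^ x)%G by rewrite -{1}(normP nGx) pHallJ2.
have [g Gg /= defPx] := Sylow_trans sylP sylPx.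
have [h Gh defg] := fpf_commg_surj nGx CG1 Gg.
exists (P :^ h^-1)%G; first by rewrite pHallJ ?groupV.
rewrite inE /= -conjsgM conjgC conjsgM defPx -conjsgM defg commgEl conjVg.
by rewrite mulgK subxx.
Qed.

Section Frobenius_sum.
Import FiniteModule.
Local Open Scope ring_scope.
Variables (V : {group gT}) (abV : abelian V).
Local Notation fm := (fmod abV).

(** The terms are permuted cyclically by [y], so the sum is a fixed point of [y] in [V]. *)
Lemma fpf_orbit_sum r y u :
    y \in 'N(V) -> (y ^+ r)%g = 1%g -> ('C_V[y] = 1)%g -> u \in V ->
  \sum_(i < r) fm (u ^ (y ^+ i)) = 0.
Proof.
move=> nVy yr1 CV1 Vu; case: r yr1 => [|n] yr1; first by rewrite big_ord0.
set s := \sum_(i < _) _.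
have fixs : actr s y = s.
  rewrite [LHS]actr_sum /s big_ord_recr [RHS]big_ord_recl /= GRing.addrC.
  congr (_ + _).
    by rewrite -fmodJ // -conjgM -expgSr yr1 expg0.
  by apply: eq_bigr => i _; rewrite -fmodJ // -conjgM -expgSr.
apply: fmod_inj; rewrite fmval0; apply/set1P; rewrite -[[set 1%g]]CV1 inE fmodP /=.
apply/cent1P/commgP/conjg_fixP.
by rewrite -[in RHS]fixs fmvalJ.
Qed.

(* The sum of the [v ^ k] over each [<[x]> :^ g] and each [<[x]> :* h] vanishes. For
   [0 < i < r], the elements [x ^+ i ^ g] and [x ^+ i * h] agree as [g], [h] run over [P],
   so comparing the terms [i = 0] gives [v ^+ #|P| = \prod_(h in P) v ^ h]. *)
Lemma fpf_cent_abelian r P x :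
    prime r -> (x ^+ r)%g = 1%g -> x \in 'N(V) -> x \in 'N(P) -> P \subset 'N(V) ->
    ('C_V[x] = 1)%g -> ('C_P[x] = 1)%g -> coprime #|V| #|P| ->
  P \subset 'C(V).
Proof.
move=> r_pr xr1 nVx nPx nVP CV1 CP1 coVP.
rewrite centsC; apply/subsetP=> v Vv.
have nVp h : h \in P -> h \in 'N(V) by apply: (subsetP nVP).
have nVxi i : (x ^+ i)%g \in 'N(V) by rewrite groupX.
pose a g := fm (v ^ g).
have sum1 : \sum_(g in P) \sum_(i < r) a (x ^+ i ^ g)%g = 0.
  apply: big1 => g Pg.
  transitivity (\sum_(i < r) fm (v ^ ((x ^ g) ^+ i)%g)).
    by apply: eq_bigr => i _; rewrite /a conjXg.
  apply: fpf_orbit_sum => //.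
  - exact: groupJ nVx (nVp g Pg).
  - by rewrite -conjXg xr1 conj1g.
  have -> : ('C_V[x ^ g] = 'C_V[x] :^ g)%g.
    by rewrite conjIg (normP (nVp g Pg)) -conjg_set1 normJ.
  by rewrite CV1 conjs1g.
have sum2 : \sum_(h in P) \sum_(i < r) a (x ^+ i * h)%g = 0.
  apply: big1 => h Ph.
  transitivity (actr (\sum_(i < r) fm (v ^ (x ^+ i)%g)) h).
    by rewrite actr_sum; apply: eq_bigr => i _; rewrite /a conjgM (fmodJ _ _ (nVp h Ph)).
  by rewrite fpf_orbit_sum // act0r.
have r_gt0 := prime_gt0 r_pr.
rewrite exchange_big (bigD1 (Ordinal r_gt0)) //= in sum1.
rewrite exchange_big (bigD1 (Ordinal r_gt0)) //= in sum2.
have eqi (i : 'I_r) : i != Ordinal r_gt0 ->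
    \sum_(g in P) a (x ^+ i ^ g)%g = \sum_(h in P) a (x ^+ i * h)%g.
  move=> nz_i.
  have CPi : ('C_P[x ^+ i] = 1)%g.
    apply/trivgP; rewrite -CP1; apply: setIS.
    apply/subsetP=> z /cent1P czx; apply/cent1P.
    (* [i] is prime to [r], so [x] is a power of [x ^+ i]. *)
    have co : coprime #|<[x]>%g| i.
      apply: (@coprime_dvdl _ r); first by rewrite -orderE order_dvdn xr1.
      rewrite prime_coprime // gtnNdvd // lt0n.
      by apply: contra nz_i => /eqP i0; apply/eqP/val_inj.
    by rewrite -(expgK co (cycle_id x)); apply: commuteX.
  have nPxi : (x ^+ i)%g \in 'N(P) by rewrite groupX.
  (* [(x ^+ i) ^ g = x ^+ i * f g], and [f] permutes [P], which reindexes one sum into the other. *)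
  pose f g := [~ x ^+ i, g]%g.
  have sfP : f @: P \subset P.
    apply/subsetP=> _ /imsetP[g Pg ->].
    by rewrite /f commgEr groupM ?memJ_norm ?groupV.
  have injf : {in P &, injective f}.
    move=> g h Pg Ph /(mulgI _) eq_gh; apply/eqP; rewrite eq_mulgV1 -in_set1.
    rewrite -[[set 1%g]]CPi inE groupM ?groupV //=; apply/cent1P/esym/commgP/conjg_fixP.
    by rewrite conjgM eq_gh conjgK.
  have fP : f @: P = P by apply/eqP; rewrite eqEcard sfP card_in_imset ?leqnn.
  rewrite -[in RHS]fP big_imset //=; apply: eq_bigr => g Pg.
  by rewrite /f commgEl mulKVg.
have eqT : fm v *+ #|P| = \sum_(h in P) fm (v ^ h).
  rewrite (eq_bigr _ eqi) in sum1.
  have /GRing.addIr eqs := etrans sum1 (esym sum2).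
  rewrite -GRing.sumr_const.
  transitivity (\sum_(g in P) a (x ^+ 0 ^ g)%g).
    by apply: eq_bigr => g _; rewrite /a expg0 conj1g conjg1.
  by rewrite eqs; apply: eq_bigr => g _; rewrite /a expg0 mul1g.
(* This power is a sum whose terms [P] only permutes; coprimality then recovers [v] from it. *)
have cvP : (v ^+ #|P|)%g \in 'C(P).
  apply/centP=> h Ph; apply/commgP/conjg_fixP.
  rewrite -{1 2}(fmodK abV Vv) -fmvalZ eqT -fmvalJ ?nVp // actr_sum; congr fmval.
  rewrite [RHS](reindex_inj (mulIg h)) /=.
  apply: eq_big => [g | g Pg]; first by rewrite groupMr.
  by rewrite -fmodJ ?nVp // conjgM.
by rewrite -(expgK coVP Vv) groupX.
Qed.
End Frobenius_sum.
End FixedPointFree.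

Theorem fpf_prime_nilpotent (gT : finGroupType) (G : {group gT}) x r :
  prime r -> x ^+ r = 1 -> x \in 'N(G) -> 'C_G[x] = 1 -> nilpotent G.
Proof.
move=> r_pr; have [n] := ubnP #|G|.
elim: n gT G x => // n IHn gT G x /ltnSE leGn xr1 nGx CG1.
have IHG (H : {group gT}) : H \proper G -> x \in 'N(H) -> nilpotent H.
  move=> prH nHx; apply: IHn nHx _ => //; first exact: leq_trans (proper_card prH) leGn.
  by apply/trivgP; rewrite -CG1 setSI ?proper_sub.
have IHQ (N : {group gT}) : N <| G -> N :!=: 1 -> x \in 'N(N) -> nilpotent (G / N).
  move=> nNG ntN nNx; apply: (IHn _ _ (coset N x)).
  - exact: leq_trans (ltn_quotient ntN (normal_sub nNG)) leGn.
  - by rewrite -morphX // xr1 morph1.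
  - by rewrite -cycle_subG -quotient_cycle // quotient_norms // cycle_subG.
  exact: fpf_quotient.
have [G1 | ntG] := eqVneq (gval G) 1; first by rewrite G1 nilpotent1.
have solvable_of (N : {group gT}) (p : nat) :
    p.-group N -> N <| G -> N :!=: 1 -> x \in 'N(N) -> solvable G.
  move=> pN nNG ntN nNx; rewrite (series_sol nNG) (pgroup_sol pN).
  by rewrite nilpotent_sol ?IHQ.
have solG : solvable G.
  have [p2G | not2G] := boolP (2.-group G); first exact: pgroup_sol p2G.
  have [p [p_pr p_dv_G odd_p]] : exists p, [/\ prime p, p %| #|G| & odd p].
    move: not2G; rewrite /pgroup /pnat cardG_gt0 /= => /allPn[p].
    rewrite mem_primes => /and3P[p_pr _ p_dv_G]; rewrite !inE => p_neq2.
    exists p; split=> //; case: (even_prime p_pr) => // p2.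
    by rewrite p2 eqxx in p_neq2.
  have [P sylP nPx] := fpf_Sylow p nGx CG1; have [sPG pP _] := and3P sylP.
  have ntP : P :!=: 1.
    by rewrite -cardG_gt1 (card_Hall sylP) p_part_gt1 mem_primes p_pr cardG_gt0.
  have nZx : x \in 'N('Ohm_1('Z(P))).
    by rewrite -cycle_subG !gFnorm_trans ?cycle_subG.
  have nJx : x \in 'N(Thompson_J P) := subsetP (norm_Thompson_J P) x nPx.
  have ntZ : 'Ohm_1('Z(P)) != 1.
    by rewrite Ohm1_eq1; apply: contra ntP => /eqP/(trivg_center_pgroup pP)->.
  have ntJ : Thompson_J P != 1 by apply: contraNneq ntP => /(@Thompson_J_eq1 _ P)->.
  have sZG : 'Ohm_1('Z(P)) \subset G.
    by rewrite (subset_trans (Ohm_sub 1 _)) ?(subset_trans (center_sub P)).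
  have sJG := subset_trans (Thompson_J_sub P) sPG.
  (* Either [X] is normal in [G], and [G / X] is nilpotent by induction, or its normalizer is a
     proper [x]-invariant subgroup, nilpotent by induction. *)
  have norm_case (X : {group gT}) : X \subset P -> X :!=: 1 -> x \in 'N(X) ->
      solvable G \/ p_nilpotent p 'N_G(X).
    move=> sXP ntX nXx; have [defG | prN] := eqVproper (subsetIl G 'N(X)).
      left; apply: (solvable_of X p) => //; first exact: pgroupS sXP pP.
      by rewrite /normal (subset_trans sXP) //=; apply/setIidPl.
    right; apply: p_nilpotent_nil; apply: IHG prN _.
    by rewrite inE conjIg (normP nGx) -normJ (normP nXx).
  have [//|nilZ] := norm_case 'Ohm_1('Z(P))%G
     (subset_trans (Ohm_sub 1 _) (center_sub P)) ntZ nZx.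
  have [//|nilJ] := norm_case (Thompson_J_group P) (Thompson_J_sub P) ntJ nJx.
  have nilC : p_nilpotent p 'C_G('Ohm_1('Z(P))).
    by apply: p_nilpotentS nilZ; rewrite setIS ?cent_sub.
  have pnG := Thompson_normal_p_complement odd_p sylP nilC nilJ.
  have nOG := pcore_normal p^' G.
  rewrite (series_sol nOG) (pgroup_sol pnG) andbT nilpotent_sol // IHG //.
    rewrite properEneq pcore_sub andbT; apply: contraTneq p_dv_G => <-.
    by rewrite -p'natE // -/(pgroup _ _) pcore_pgroup.
  by rewrite -cycle_subG gFnorm_trans ?cycle_subG.
(* The abelian normal subgroup is found in [G <*> <[x]>] so that it is also [x]-invariant. *)
have nGL : G <| G <*> <[x]> by rewrite normalYl cycle_subG.
have [N [sNG nNL ntN abelN]] := solvable_norm_abelem solG nGL ntG.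
have [q q_pr abelqN] := is_abelemP abelN.
have [qN abN _] := and3P abelqN.
have nNG : N <| G := normalS sNG (joing_subl _ _) nNL.
have nNx : x \in 'N(N).
  by rewrite -cycle_subG (subset_trans (joing_subr G _)) ?normal_norm.
have nilGN := IHQ N nNG ntN nNx.
have CN1 : 'C_N[x] = 1 by apply/trivgP; rewrite -CG1 setSI.
(* [N <*> P] is normal because [G / N] is nilpotent. If [p = q], it is [P]; otherwise [P]
   centralizes [N] and is characteristic in [N <*> P]. *)
have normal_Sylow p : exists2 P : {group gT}, p.-Sylow(G) P & P <| G.
  have [P sylP nPx] := fpf_Sylow p nGx CG1; have [sPG pP _] := and3P sylP.
  exists P => //; have nNP := subset_trans sPG (normal_norm nNG).
  have sylPN : p.-Sylow(G / N) (P / N) by apply: quotient_pHall.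
  have defPN := nilpotent_Hall_pcore nilGN sylPN.
  have nPNG : N <*> P <| G.
    have <- : coset N @*^-1 (P / N) = N <*> P by rewrite quotientK // norm_joinEr.
    by rewrite -(quotientGK nNG) cosetpre_normal /= defPN pcore_normal.
  have [eq_pq | neq_pq] := eqVneq p q.
    have sNP : N \subset P.
      by rewrite (normal_sub_max_pgroup (Hall_max sylP)) // eq_pq.
    by rewrite (joing_idPr sNP) in nPNG.
  have co : coprime #|N| #|P|.
    apply: (pnat_coprime qN); apply: pi_pnat pP _; rewrite !inE //.
  have cNP : P \subset 'C(N).
    apply: (fpf_cent_abelian abN r_pr xr1) => //.
    by apply/trivgP; rewrite -CG1 setSI.
  have nPP : P <| N <*> P.
    by rewrite /normal joing_subr join_subG normG andbT cents_norm // centsC.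
  have sylPY : p.-Sylow(N <*> P) P.
    by rewrite (pHall_subl _ _ sylP) ?joing_subr // join_subG sNG.
  by rewrite -(normal_Hall_pcore sylPY nPP) gFnormal_trans.
rewrite -(Sylow_gen G); apply: nilpotentS (Fitting_nil G).
rewrite gen_subG; apply/bigcupsP=> P /SylowP[p p_pr sylP].
have [Q sylQ nQG] := normal_Sylow p.
have [g Gg ->] := Sylow_trans sylQ sylP.
rewrite (normsP (normal_norm nQG)) // Fitting_max //.
by case/and3P: sylQ => _ pQ _; apply: pgroup_nil pQ.
Qed.

(** * Maximal subgroups of a semigroup *)

Section UnitGroup.
Variables (S : finType) (mul : S -> S -> S) (e : S).
Hypotheses (mulA : associative mul) (ee : mul e e = e).
Local Notation "x ** y" := (mul x y) (at level 40, left associativity).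

(** The units of the local monoid at [e], as a boolean predicate so that they form a finite type. *)
Definition unit_at (x : S) : bool :=
  [&& e ** x == x, x ** e == x &
    [exists y, [&& e ** y == y, y ** e == y, x ** y == e & y ** x == e]]].

Lemma unit_atP x :
  reflect [/\ e ** x = x, x ** e = x &
              exists y, [/\ e ** y = y, y ** e = y, x ** y = e & y ** x = e]]
          (unit_at x).
Proof.
apply: (iffP and3P) => [[/eqP ex /eqP xe /existsP[y /and4P[]]] | [ex xe [y [ey ye xy yx]]]].
  by move=> /eqP ey /eqP ye /eqP xy /eqP yx; split=> //; exists y.
by rewrite ex xe; split=> //; apply/existsP; exists y; rewrite ey ye xy yx !eqxx.
Qed.

Lemma unit_at_idem : unit_at e.
Proof. by apply/unit_atP; split=> //; exists e. Qed.

Lemma unit_at_mul x y : unit_at x -> unit_at y -> unit_at (x ** y).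
Proof.
move=> /unit_atP[ex xe [x' [ex' x'e xx' x'x]]] /unit_atP[ey ye [y' [ey' y'e yy' y'y]]].
apply/unit_atP; split; rewrite ?mulA ?ex // -?mulA ?ye //.
exists (y' ** x'); split; rewrite ?mulA ?ey' // -?mulA ?x'e //.
  by rewrite (mulA y) yy' ex'.
by rewrite (mulA x') x'x ey.
Qed.

Lemma unit_at_inv x : unit_at x ->
  exists2 y, unit_at y & x ** y = e /\ y ** x = e.
Proof.
move=> /unit_atP[ex xe [y [ey ye xy yx]]]; exists y => //.
by apply/unit_atP; split=> //; exists x.
Qed.

Lemma unit_at_greenH x : greenH mul x e <-> unit_at x.
Proof.
split=> [[[Rxe Rex] [Lxe Lex]] | /unit_atP[ex xe [y [ey ye xy yx]]]]; last first.
  split; split; right; [by exists x | by exists y | by exists x | by exists y].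
have ex : e ** x = x by case: Rxe => [->|[s ->]] //; rewrite mulA ee.
have xe : x ** e = x by case: Lxe => [->|[s ->]] //; rewrite -mulA ee.
have [t xt] : exists t, x ** t = e.
  by case: Rex => [<-|[t ->]]; [exists e | exists t].
have [s sx] : exists s, s ** x = e.
  by case: Lex => [<-|[s ->]]; [exists e | exists s].
(* The right inverse [t] and the left inverse [s] agree once cut down by [e] on both sides. *)
apply/unit_atP; split=> //; exists (e ** t ** e).
have xt' : x ** (e ** t ** e) = e by rewrite !mulA xe xt ee.
have sx' : e ** s ** e ** x = e by rewrite -!mulA ex sx ee.
split=> //; first by rewrite !mulA ee.
  by rewrite -mulA ee.
suffices -> : e ** t ** e = e ** s ** e by [].
transitivity (e ** s ** e ** x ** (e ** t ** e)); first by rewrite sx' !mulA ee.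
by rewrite -mulA xt' -mulA ee.
Qed.

Lemma unit_at_idempotent x : unit_at x -> x ** x = x -> x = e.
Proof. by move=> /unit_atP[ex xe [y [_ _ xy _]]] xx; rewrite -[LHS]xe -[in LHS]xy mulA xx. Qed.

Local Notation unit_type := {x : S | unit_at x}.

Definition unit_one : unit_type := exist _ e unit_at_idem.
Definition unit_mul (x y : unit_type) : unit_type :=
  exist _ (val x ** val y) (unit_at_mul (valP x) (valP y)).

Lemma unit_mulI x : injective (unit_mul^~ x).
Proof.
move=> u v /(congr1 val) /= eq_ux; apply: val_inj.
have [y _ [xy _]] := unit_at_inv (valP x).
have /unit_atP[_ ue _] := valP u; have /unit_atP[_ ve _] := valP v.
by rewrite -ue -ve -xy !mulA eq_ux.
Qed.

(** The right regular representation places the units and the permutation induced by [alpha] in one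
    permutation group, where [alpha] acts by conjugation. *)
Definition unit_perm x : {perm unit_type} := perm (@unit_mulI x).

Lemma unit_permE x y : val (unit_perm x y) = val y ** val x.
Proof. by rewrite permE. Qed.

Lemma unit_perm_one x : unit_perm x unit_one = x.
Proof.
by apply: val_inj; rewrite unit_permE /=; have /unit_atP[] := valP x.
Qed.

Lemma unit_permM x y : unit_perm (unit_mul x y) = unit_perm x * unit_perm y.
Proof.
by apply/permP=> u; apply: val_inj; rewrite permM !unit_permE /= mulA.
Qed.

Lemma unit_perm1 : unit_perm unit_one = 1.
Proof.
apply/permP=> u; apply: val_inj; rewrite unit_permE perm1 /=.
by have /unit_atP[] := valP u.
Qed.

Definition unit_group : {set {perm unit_type}} := [set unit_perm x | x : unit_type].

Lemma unit_group_set : group_set unit_group.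
Proof.
apply/group_setP; split; first by rewrite -unit_perm1 imset_f.
by move=> _ _ /imsetP[x _ ->] /imsetP[y _ ->]; rewrite -unit_permM imset_f.
Qed.
Canonical unit_group_group := Group unit_group_set.

Lemma nilpotent_maximal_subgroup_units :
  nilpotent unit_group -> nilpotent_maximal_subgroup mul e.
Proof.
move=> nilG; exists (subg_of unit_group_group).
(* A right translation is recovered from its value at [unit_one]. *)
exists (fun s => val ((sgval s : {perm unit_type}) unit_one)).
have GE (s : subg_of unit_group_group) : exists x, sgval s = unit_perm x.
  by have /imsetP[x _ ->] := subgP s; exists x.
split=> [s t | s t | x | ].
- have [[x sx] [y ty]] := (GE s, GE t).
  rewrite sx ty !unit_perm_one => /val_inj eq_xy; apply: val_inj.
  by rewrite /= sx ty eq_xy.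
- have [[x sx] [y ty]] := (GE s, GE t).
  by rewrite /= sx ty -unit_permM !unit_perm_one.
- split=> [/unit_at_greenH Ux | [s <-]].
    exists (subg unit_group_group (unit_perm (exist _ x Ux))).
    by rewrite subgK ?imset_f ?unit_perm_one.
  by apply/unit_at_greenH; have [y ->] := GE s; rewrite unit_perm_one; apply: valP.
by rewrite -(isog_nil (isog_subg unit_group_group)).
Qed.

Variables (alpha : S -> S) (p : nat).
Hypotheses (alphaM : {morph alpha : x y / x ** y}) (alpha_e : alpha e = e).
Hypotheses (p_pr : prime p) (alphap : forall x, iter p alpha x = x).
Hypothesis fix_alpha : forall x, alpha x = x -> x ** x = x.

Lemma unit_at_alpha x : unit_at x -> unit_at (alpha x).
Proof.
move=> /unit_atP[ex xe [y [ey ye xy yx]]]; apply/unit_atP.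
rewrite -{1 2}alpha_e -!alphaM ex xe; split=> //; exists (alpha y).
by rewrite -!alphaM -{1 2}alpha_e -!alphaM ey ye xy yx.
Qed.

Definition unit_alpha (x : unit_type) : unit_type :=
  exist _ (alpha (val x)) (unit_at_alpha (valP x)).

Lemma unit_alpha_inj : injective unit_alpha.
Proof.
move=> x y /(congr1 val) /= eq_xy; apply: val_inj.
by rewrite -[val x]alphap -[val y]alphap -(prednK (prime_gt0 p_pr)) !iterSr eq_xy.
Qed.

Definition alpha_perm : {perm unit_type} := perm unit_alpha_inj.

Lemma alpha_permJ x : unit_perm x ^ alpha_perm = unit_perm (unit_alpha x).
Proof.
apply/permP=> u; rewrite -[u](permKV alpha_perm) permJ; apply: val_inj.
by rewrite unit_permE [in LHS]permE /= unit_permE [in RHS]permE /= alphaM.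
Qed.

Lemma alpha_perm_norm : alpha_perm \in 'N(unit_group).
Proof.
rewrite inE; apply/subsetP=> _ /imsetP[_ /imsetP[x _ ->] ->].
by rewrite alpha_permJ imset_f.
Qed.

Lemma alpha_perm_exp : alpha_perm ^+ p = 1.
Proof.
apply/permP=> u; rewrite permX perm1; apply: val_inj.
rewrite -[RHS]alphap; elim: p => //= k IHk.
by rewrite permE /= IHk.
Qed.

Lemma alpha_perm_fpf : 'C_(unit_group)[alpha_perm] = 1.
Proof.
apply/trivgP/subsetP=> _ /setIP[/imsetP[x _ ->] /cent1P cxa].
have /(congr1 (fun s : {perm unit_type} => val (s unit_one))) :
    unit_perm x ^ alpha_perm = unit_perm x by apply/conjg_fixP/commgP.
rewrite alpha_permJ !unit_perm_one /= => /fix_alpha/(unit_at_idempotent (valP x)) xe.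
by rewrite inE -unit_perm1; apply/eqP; congr unit_perm; apply: val_inj.
Qed.

Lemma unit_group_nilpotent : nilpotent unit_group.
Proof.
exact: fpf_prime_nilpotent p_pr alpha_perm_exp alpha_perm_norm alpha_perm_fpf.
Qed.

(** Surjectivity of [k |-> k^-1 * alpha k] on the units, from [fpf_commg_surj]; it serves to correct
    [x] to a fixed element. *)
Lemma unit_at_coboundary g : unit_at g ->
  exists k k', [/\ unit_at k, unit_at k', k ** k' = e, k' ** k = e & k ** g = alpha k].
Proof.
move=> Ug; have Gg : unit_perm (exist _ g Ug) \in unit_group by rewrite imset_f.
have [_ /imsetP[k _ ->] defg] := fpf_commg_surj alpha_perm_norm alpha_perm_fpf Gg.
have [k' Uk' [kk' k'k]] := unit_at_inv (valP k).
exists (val k), k'; split=> //; first exact: valP.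
have := congr1 (mulg (unit_perm k)) defg.
rewrite commgEl mulKVg alpha_permJ -unit_permM.
by move/(congr1 (fun s : {perm unit_type} => val (s unit_one))); rewrite !unit_perm_one.
Qed.
End UnitGroup.

(** * Clifford property and nilpotent maximal subgroups *)

Theorem theorem1p2 (S : finType) (mul : S -> S -> S) (alpha : S -> S) (p : nat) :
  inverse_semigroup mul ->
  semigroup_automorphism mul alpha ->
  prime p -> aut_order alpha p ->
  (forall x : S, alpha x = x <-> idempotent_el mul x) ->
  clifford mul /\
  (forall e : S, idempotent_el mul e -> nilpotent_maximal_subgroup mul e).
Proof.
move=> [mulA uniq_inv] [_ alphaM] p_pr [_ [alphap _]] fixE; split; last first.
  move=> e ee; have alpha_e : alpha e = e by apply/fixE.
  apply: (nilpotent_maximal_subgroup_units (mulA := mulA) ee).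
  apply: (unit_group_nilpotent mulA ee alphaM alpha_e p_pr alphap) => x.
  by move/fixE.
move=> x y [xyx yxy].
pose e := mul x y; pose f := mul y x.
have ee : mul e e = e by rewrite /e mulA xyx.
have ff : mul f f = f by rewrite /f mulA yxy.
have ae : alpha e = e by apply/fixE.
have af : alpha f = f by apply/fixE.
(* This [g] satisfies [x g = alpha x]; its inverse at [f] is [(alpha y) x]. *)
pose g := mul y (alpha x).
have Ug : unit_at mul f g.
  apply/unit_atP; split.
  - by rewrite /f /g mulA yxy.
  - by rewrite /g -mulA -af -alphaM /f mulA xyx.
  exists (mul (alpha y) x); split.
  - by rewrite mulA -af -alphaM /f yxy.
  - by rewrite /f -mulA (mulA x) xyx.
  - by rewrite /g -mulA (mulA (alpha x)) -alphaM ae /e -/(mul _ _) mulA mulA yxy.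
  by rewrite -mulA (mulA x) -/e -ae -!alphaM /e xyx.
have [k [k' [Uk Uk' kk' k'k kg]]] :=
  unit_at_coboundary mulA ff alphaM af p_pr alphap (fun x H => (fixE x).1 H) Ug.
have [/unit_atP[fk kf _] /unit_atP[fk' k'f _]] := (Uk, Uk').
(* Since [g = k' (alpha k)], [z] is fixed: [alpha z = x g (alpha k') = x k' (alpha (k k')) = z]. *)
pose z := mul x k'; pose w := mul k y.
have zz : mul z z = z.
  apply/fixE; rewrite /z alphaM; have -> : alpha x = mul x g.
    by rewrite /g mulA -/e -ae -alphaM /e xyx.
  have <- : mul k' (alpha k) = g by rewrite -kg mulA k'k; case/unit_atP: Ug.
  by rewrite -mulA -mulA -alphaM kk' af k'f.
have zw : mul z w = e by rewrite /z /w mulA -(mulA x) k'k /f mulA xyx.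
have wz : mul w z = f by rewrite /z /w mulA -(mulA k) -/f kf kk'.
(* The idempotent [z] is its own inverse, and [w] is also an inverse of [z]; uniqueness gives
   [z = w], whence [e = z w = w z = f]. *)
have [z' [_ uz']] := uniq_inv z.
have z_z : z' = z by apply: uz'; rewrite /is_inverse_of !zz.
have z_w : z' = w.
  apply: uz'; rewrite /is_inverse_of zw wz; split; first by rewrite /z /e mulA xyx.
  by rewrite /w mulA fk.
by rewrite -/e -/f -zw -wz -z_w z_z.
Qed.
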